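(* Say that Conjecture A holds for a fusion system $\mathcal{F}$ over a finite $p$-group $S$ if for every $\mathbb{Z}$-basis $B$ of $R_{\mathbb{C}}(\mathcal{F})$ one has $$|\det(X_B(\mathcal{F}))|^2=\prod_{x\in \mathrm{fccl}(\mathcal{F})}|C_S(x)|.$$ Then: (1) Conjecture A holds for $\mathcal{F}$ whenever $\mathcal{F}$ is transitive, i.e. $|\mathrm{cl}(\mathcal{F})|=2$; (2) Conjecture A holds for $\mathcal{F}$ whenever $\mathcal{F}=\mathcal{F}_S(G)$ for some finite group $G$ with $S\in\mathrm{Syl}_p(G)$; (3) if $\mathcal{F}_1,\mathcal{F}_2$ are fusion systems over finite $p$-groups $S_1,S_2$ and Conjecture A holds for $\mathcal{F}_1$ and for $\mathcal{F}_2$, then Conjecture A holds for $\mathcal{F}_1\times\mathcal{F}_2$.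
   Context: Let $p$ be a prime and $S$ a finite $p$-group. A fusion system $\mathcal{F}$ over $S$ is a category whose objects are the subgroups of $S$, whose morphism sets $\mathrm{Hom}_{\mathcal{F}}(P,Q)$ consist of injective group homomorphisms $P\to Q$ (with usual composition), such that every homomorphism $P\to Q$ induced by conjugation by an element of $S$ lies in $\mathrm{Hom}_{\mathcal{F}}(P,Q)$, and every morphism is the composite of an isomorphism in $\mathcal{F}$ followed by an inclusion. No saturation is assumed. For a finite group $G$ with $S\le G$, $\mathcal{F}_S(G)$ is the fusion system over $S$ with $\mathrm{Hom}(P,Q)$ the set of all homomorphisms $P\to Q$ induced by conjugation by elements of $G$. The $\mathcal{F}$-conjugacy class of $s\in S$ is $s^{\mathcal{F}}=\{s'\in S: \exists P,Q\le S,\ \exists\phi\in\mathrm{Hom}_{\mathcal{F}}(P,Q)\text{ with }\phi(s')=s\}$; $\mathrm{cl}(\mathcal{F})$ is the set of these classes. An element $x\in S$ is fully $\mathcal{F}$-centralised if $|C_S(x)|\ge|C_S(y)|$ for all $y\in x^{\mathcal{F}}$; $\mathrm{fccl}(\mathcal{F})$ is a set of fully $\mathcal{F}$-centralised representatives, one for each class in $\mathrm{cl}(\mathcal{F})$. A class function on $S$ is $\mathcal{F}$-stable if it is constant on $\mathcal{F}$-conjugacy classes. $R_{\mathbb{C}}(\mathcal{F})$ is the ring of $\mathcal{F}$-stable virtual complex characters of $S$ (equivalently, the Grothendieck completion of the semiring of $\mathcal{F}$-stable complex characters of $S$); it is a free abelian group of rank $|\mathrm{cl}(\mathcal{F})|$.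 For a $\mathbb{Z}$-basis $B$ of it, $X_B(\mathcal{F})$ is the square matrix $(\psi(x))_{\psi\in B,\,x^{\mathcal{F}}\in\mathrm{cl}(\mathcal{F})}$. The product $\mathcal{F}_1\times\mathcal{F}_2$ is the fusion system over $S_1\times S_2$ in which, for $P,Q\le S_1\times S_2$ with projections $P_i,Q_i$ to $S_i$, $\mathrm{Hom}_{\mathcal{F}_1\times\mathcal{F}_2}(P,Q)=\{(\phi_1,\phi_2)|_P:\phi_i\in\mathrm{Hom}_{\mathcal{F}_i}(P_i,Q_i),\ (\phi_1,\phi_2)(P)\le Q\}$. *)

(* Defs.v *)
From mathcomp Require Import all_boot all_order all_algebra.
From mathcomp Require Import all_fingroup all_solvable all_field all_character.

Set Implicit Arguments.
Unset Strict Implicit.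
Unset Printing Implicit Defensive.

Import GroupScope GRing.Theory Num.Theory.

(* Hom-sets consist of functions between the subgroup types [subg P] and      *)
(* [subg Q], so that equality of morphisms is plain equality.                 *)

Definition hom_sets (gT : finGroupType) :=
  forall P Q : {group gT}, {set {ffun [subg P] -> [subg Q]}}.

Definition hom_iso (gT : finGroupType) (hom : hom_sets gT)
    (P R : {group gT}) (h : {ffun [subg P] -> [subg R]}) : Prop :=
  h \in hom P R /\ exists k, [/\ k \in hom R P, cancel h k & cancel k h].

(* Identities and inclusions are the case s = 1 of fhom_conj.                 *)
Record fusion_system (gT : finGroupType) (S : {group gT}) := FusionSystem {
  fhom : hom_sets gT;
  fhom_obj : forall P Q f, f \in fhom P Q -> P \subset S /\ Q \subset S;
  fhom_morph : forall P Q f, f \in fhom P Q -> {morph f : x y / x * y};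
  fhom_inj : forall P Q f, f \in fhom P Q -> injective f;
  fhom_comp : forall P Q R f g, f \in fhom P Q -> g \in fhom Q R ->
    [ffun x => g (f x)] \in fhom P R;
  fhom_conj : forall P Q (f : {ffun [subg P] -> [subg Q]}) s,
    P \subset S -> Q \subset S -> s \in S ->
    (forall x, sgval (f x) = sgval x ^ s) -> f \in fhom P Q;
  fhom_fact : forall P Q f, f \in fhom P Q ->
    exists2 R : {group gT}, R \subset Q &
    exists2 h : {ffun [subg P] -> [subg R]}, hom_iso fhom h &
      forall x, sgval (f x) = sgval (h x)
}.

Section FusionClasses.

Variables (gT : finGroupType) (S : {group gT}) (F : fusion_system S).

Definition fclass (s : gT) : {set gT} :=
  [set s' in S | [exists P : {group gT}, [exists Q : {group gT},
    [exists f in fhom F P Q, [exists x, (sgval x == s') && (sgval (f x) == s)]]]]].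

Definition fcl : {set {set gT}} := [set fclass s | s in S].

Definition fully_centralised (x : gT) : bool :=
  (x \in S) && [forall y in fclass x, (#|'C_S[y]| <= #|'C_S[x]|)%N].

Definition is_fccl (X : {set gT}) : bool :=
  [forall x in X, fully_centralised x] && [forall C in fcl, #|X :&: C| == 1%N].

Definition fstable (phi : 'CF(S)) : bool :=
  [forall x in S, [forall y in fclass x, phi y == phi x]].

Definition stable_vchar : {pred 'CF(S)} :=
  [pred phi | (phi \in 'Z[irr S]) && fstable phi].

End FusionClasses.

Section ConjectureA.

Local Open Scope ring_scope.

Definition is_Zbasis (V : zmodType) (R : {pred V}) (n : nat)
    (B : 'I_n -> V) : Prop :=
  (forall i, B i \in R) /\
  (forall v, v \in R -> exists! c : {ffun 'I_n -> int}, v = \sum_i B i *~ c i).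

(* As F-stable virtual characters are constant on F-classes, evaluating them  *)
(* at the representative chosen by repr involves no choice.                   *)
Definition char_matrix (gT : finGroupType) (S : {group gT})
    (F : fusion_system S) (B : 'I_#|fcl F| -> 'CF(S)) : 'M[algC]_#|fcl F| :=
  \matrix_(i, j) B i (repr (enum_val j)).

(* The stable virtual characters form a free abelian group of rank #|fcl F|,  *)
(* so indexing bases by 'I_#|fcl F| excludes none of them.                    *)
Definition conjectureA (gT : finGroupType) (S : {group gT})
    (F : fusion_system S) : Prop :=
  forall B : 'I_#|fcl F| -> 'CF(S), is_Zbasis (stable_vchar F) B ->
  forall X : {set gT}, is_fccl F X ->
    `|\det (char_matrix B)| ^+ 2 = (\prod_(x in X) #|'C_S[x]|)%N%:R.

End ConjectureA.

Section GroupFusion.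

Variables (gT : finGroupType) (S G : {group gT}).

Definition group_hom : hom_sets gT := fun P Q =>
  [set f : {ffun [subg P] -> [subg Q]} | [&& P \subset S, Q \subset S &
    [exists g in G, [forall x, sgval (f x) == sgval x ^ g]]]].

Lemma group_homP (P Q : {group gT}) (f : {ffun [subg P] -> [subg Q]}) :
  reflect [/\ P \subset S, Q \subset S &
            exists2 g, g \in G & forall x, sgval (f x) = sgval x ^ g]
          (f \in group_hom P Q).
Proof.
rewrite inE; apply: (iffP and3P) => [[sP sQ]|[sP sQ [g Gg fE]]].
  by case/exists_inP=> g Gg /forallP fE; split=> //; exists g => // x; apply/eqP.
by split=> //; apply/exists_inP; exists g => //; apply/forallP=> x; apply/eqP.
Qed.

Hypothesis sSG : S \subset G.

Lemma group_hom_obj P Q f : f \in group_hom P Q -> P \subset S /\ Q \subset S.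
Proof. by case/group_homP. Qed.

Lemma group_hom_morph P Q f :
  f \in group_hom P Q -> {morph f : x y / x * y}.
Proof.
case/group_homP=> _ _ [g _ fE] x y; apply: val_inj => /=.
by rewrite !fE -conjMg.
Qed.

Lemma group_hom_inj P Q f : f \in group_hom P Q -> injective f.
Proof.
case/group_homP=> _ _ [g _ fE] x y /(congr1 sgval); rewrite !fE.
by move/conjg_inj; apply: val_inj.
Qed.

Lemma group_hom_comp P Q R f h : f \in group_hom P Q -> h \in group_hom Q R ->
  [ffun x => h (f x)] \in group_hom P R.
Proof.
case/group_homP=> sP _ [g Gg fE] /group_homP[_ sR [k Gk hE]].
apply/group_homP; split=> //; exists (g * k); first exact: groupM.
by move=> x; rewrite ffunE hE fE conjgM.
Qed.

Lemma group_hom_conj P Q (f : {ffun [subg P] -> [subg Q]}) s :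
  P \subset S -> Q \subset S -> s \in S ->
  (forall x, sgval (f x) = sgval x ^ s) -> f \in group_hom P Q.
Proof.
move=> sP sQ Ss fE; apply/group_homP; split=> //.
by exists s => //; apply: (subsetP sSG).
Qed.

Lemma group_hom_fact P Q f : f \in group_hom P Q ->
  exists2 R : {group gT}, R \subset Q &
  exists2 h : {ffun [subg P] -> [subg R]}, hom_iso group_hom h &
    forall x, sgval (f x) = sgval (h x).
Proof.
case/group_homP=> sP sQ [g Gg fE].
have sRQ : P :^ g \subset Q.
  apply/subsetP=> _ /imsetP[x Px ->].
  by have := subgP (f (Subg Px)); rewrite fE.
have sRS := subset_trans sRQ sQ.
exists (P :^ g)%G => //=.
pose h : {ffun [subg P] -> [subg (P :^ g)%G]} :=
  [ffun x => subg (P :^ g)%G (sgval x ^ g)].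
have hE x : sgval (h x) = sgval x ^ g.
  by rewrite ffunE subgK //= memJ_conjg subgP.
pose k : {ffun [subg (P :^ g)%G] -> [subg P]} :=
  [ffun x => subg P (sgval x ^ g^-1)].
have kE x : sgval (k x) = sgval x ^ g^-1.
  by rewrite ffunE subgK // -mem_conjg; apply: subgP.
exists h; last by move=> x; rewrite hE fE.
split; first by apply/group_homP; split=> //; exists g.
exists k; split.
- by apply/group_homP; split=> //; exists g^-1; rewrite ?groupV.
- by move=> x; apply: val_inj; rewrite /= kE hE conjgK.
- by move=> x; apply: val_inj; rewrite /= hE kE conjgKV.
Qed.

Definition group_fusion : fusion_system S :=
  FusionSystem group_hom_obj group_hom_morph group_hom_inj group_hom_comp
    group_hom_conj group_hom_fact.

End GroupFusion.

Section ProductFusion.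

Variables (gT1 gT2 : finGroupType) (S1 : {group gT1}) (S2 : {group gT2}).
Variables (F1 : fusion_system S1) (F2 : fusion_system S2).

Local Notation gT := (gT1 * gT2)%type.
Local Notation S := (setX_group S1 S2).

Definition proj1G (P : {group gT}) : {group gT1} := (@fst gT1 gT2 @* P)%G.
Definition proj2G (P : {group gT}) : {group gT2} := (@snd gT1 gT2 @* P)%G.

Lemma mem_proj1G (P : {group gT}) (x : [subg P]) : (sgval x).1 \in proj1G P.
Proof. by apply: mem_morphim; rewrite ?inE ?subgP. Qed.

Lemma mem_proj2G (P : {group gT}) (x : [subg P]) : (sgval x).2 \in proj2G P.
Proof. by apply: mem_morphim; rewrite ?inE ?subgP. Qed.

Definition to1 (P : {group gT}) (x : [subg P]) : [subg proj1G P] :=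
  Subg (mem_proj1G x).
Definition to2 (P : {group gT}) (x : [subg P]) : [subg proj2G P] :=
  Subg (mem_proj2G x).

(* The condition (phi_1, phi_2)(P) <= Q is carried by the type of f.          *)
Definition prod_hom : hom_sets gT := fun P Q =>
  [set f : {ffun [subg P] -> [subg Q]} | [&& P \subset S, Q \subset S &
    [exists f1 in fhom F1 (proj1G P) (proj1G Q),
     exists f2 in fhom F2 (proj2G P) (proj2G Q),
     forall x, sgval (f x) == (sgval (f1 (to1 x)), sgval (f2 (to2 x)))]]].


Lemma prod_homP (P Q : {group gT}) (f : {ffun [subg P] -> [subg Q]}) :
  reflect [/\ P \subset S, Q \subset S &
    exists2 f1, f1 \in fhom F1 (proj1G P) (proj1G Q) &
    exists2 f2, f2 \in fhom F2 (proj2G P) (proj2G Q) &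
    forall x, sgval (f x) = (sgval (f1 (to1 x)), sgval (f2 (to2 x)))]
  (f \in prod_hom P Q).
Proof.
rewrite inE; apply: (iffP and3P) => [[sP sQ]|[sP sQ [f1 f1F [f2 f2F fE]]]].
  case/exists_inP=> f1 f1F /exists_inP[f2 f2F /forallP fE].
  by split=> //; exists f1 => //; exists f2 => // x; apply/eqP.
split=> //; apply/exists_inP; exists f1 => //; apply/exists_inP; exists f2 => //.
by apply/forallP=> x; apply/eqP.
Qed.

Lemma proj1G_sub (P : {group gT}) : P \subset S -> proj1G P \subset S1.
Proof.
move=> sP; apply/subsetP=> _ /morphimP[x _ Px ->].
by have := subsetP sP x Px; rewrite inE => /andP[].
Qed.

Lemma proj2G_sub (P : {group gT}) : P \subset S -> proj2G P \subset S2.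
Proof.
move=> sP; apply/subsetP=> _ /morphimP[x _ Px ->].
by have := subsetP sP x Px; rewrite inE => /andP[].
Qed.

Lemma to1_surj (P : {group gT}) (y : [subg proj1G P]) : exists x, y = @to1 P x.
Proof.
case/morphimP: (subgP y) => x _ Px yE; exists (Subg Px).
exact: val_inj.
Qed.

Lemma to2_surj (P : {group gT}) (y : [subg proj2G P]) : exists x, y = @to2 P x.
Proof.
case/morphimP: (subgP y) => x _ Px yE; exists (Subg Px).
exact: val_inj.
Qed.

Lemma prod_hom_obj P Q f : f \in prod_hom P Q -> P \subset S /\ Q \subset S.
Proof. by case/prod_homP. Qed.

Lemma to1M (P : {group gT}) : {morph @to1 P : x y / x * y}.
Proof. by move=> x y; apply: val_inj. Qed.

Lemma to2M (P : {group gT}) : {morph @to2 P : x y / x * y}.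
Proof. by move=> x y; apply: val_inj. Qed.

Lemma prod_hom_morph P Q f : f \in prod_hom P Q -> {morph f : x y / x * y}.
Proof.
case/prod_homP=> _ _ [f1 f1F [f2 f2F fE]] x y; apply: val_inj => /=.
by rewrite !fE to1M to2M (fhom_morph f1F) (fhom_morph f2F).
Qed.

Lemma prod_hom_inj P Q f : f \in prod_hom P Q -> injective f.
Proof.
case/prod_homP=> _ _ [f1 f1F [f2 f2F fE]] x y /(congr1 sgval).
rewrite !fE => -[/val_inj/(fhom_inj f1F)/(congr1 sgval)/= e1].
move=> /val_inj/(fhom_inj f2F)/(congr1 sgval)/= e2; apply: val_inj => /=.
by rewrite [LHS]surjective_pairing [RHS]surjective_pairing e1 e2.
Qed.

Lemma prod_hom_comp P Q R f h : f \in prod_hom P Q -> h \in prod_hom Q R ->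
  [ffun x => h (f x)] \in prod_hom P R.
Proof.
case/prod_homP=> sP _ [f1 f1F [f2 f2F fE]].
case/prod_homP=> _ sR [h1 h1F [h2 h2F hE]].
apply/prod_homP; split=> //.
exists [ffun x => h1 (f1 x)]; first exact: fhom_comp f1F h1F.
exists [ffun x => h2 (f2 x)]; first exact: fhom_comp f2F h2F.
move=> x; rewrite !ffunE hE.
by congr (sgval (h1 _), sgval (h2 _)); apply: val_inj; rewrite /= fE.
Qed.

Lemma prod_hom_conj P Q (f : {ffun [subg P] -> [subg Q]}) s :
  P \subset S -> Q \subset S -> s \in S ->
  (forall x, sgval (f x) = sgval x ^ s) -> f \in prod_hom P Q.
Proof.
move=> sP sQ Ss fE; have /andP[s1 s2]: (s.1 \in S1) && (s.2 \in S2).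
  by move: Ss; rewrite inE.
have Q1 (x : [subg proj1G P]) : sgval x ^ s.1 \in proj1G Q.
  by have [y ->] := to1_surj x; have := mem_proj1G (f y); rewrite fE.
have Q2 (x : [subg proj2G P]) : sgval x ^ s.2 \in proj2G Q.
  by have [y ->] := to2_surj x; have := mem_proj2G (f y); rewrite fE.
apply/prod_homP; split=> //.
exists [ffun x => Subg (Q1 x)].
  apply: (@fhom_conj _ _ F1 _ _ _ s.1); rewrite ?proj1G_sub // => x.
  by rewrite ffunE.
exists [ffun x => Subg (Q2 x)].
  apply: (@fhom_conj _ _ F2 _ _ _ s.2); rewrite ?proj2G_sub // => x.
  by rewrite ffunE.
by move=> x; rewrite !ffunE fE.
Qed.

Lemma prod_hom_fact P Q f : f \in prod_hom P Q ->
  exists2 R : {group gT}, R \subset Q &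
  exists2 h : {ffun [subg P] -> [subg R]}, hom_iso prod_hom h &
    forall x, sgval (f x) = sgval (h x).
Proof.
move=> fF; case/prod_homP: (fF) => sP sQ [f1 f1F [f2 f2F fE]].
have fM : {in setT &, {morph f : x y / x * y}}.
  by move=> x y _ _; apply: prod_hom_morph fF _ _.
pose R : {group gT} := (sgval @* (Morphism fM @* setT))%G.
have memR x : sgval (f x) \in R.
  by apply: mem_morphim; rewrite ?inE // (@mem_morphim _ _ _ (Morphism fM)) ?inE.
have Rf (y : [subg R]) : exists x, sgval y = sgval (f x).
  have /morphimP[z _ /morphimP[x _ _ ->] yE] := subgP y.
  by exists x.
have sRQ : R \subset Q.
  by apply/subsetP=> y Ry; have [x /= ->] := Rf (Subg Ry); apply: subgP.
exists R => //; have sRS := subset_trans sRQ sQ.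
have [R1 _ [h1 [h1F [k1 [k1F h1K k1K]]] h1E]] := fhom_fact f1F.
have [R2 _ [h2 [h2F [k2 [k2F h2K k2K]]] h2E]] := fhom_fact f2F.
have eR1 : R1 = proj1G R.
  apply/val_inj/setP => y /=; apply/idP/idP => [R1y|].
    have [x xE] := to1_surj (k1 (Subg R1y)).
    have -> : y = (sgval (f x)).1 by rewrite fE /= h1E -xE k1K.
    exact: (mem_proj1G (Subg (memR x))).
  move=> Ry; have [z /(congr1 sgval)/= ->] := @to1_surj R (Subg Ry).
  by have [x ->] := Rf z; rewrite fE /= h1E subgP.
have eR2 : R2 = proj2G R.
  apply/val_inj/setP => y /=; apply/idP/idP => [R2y|].
    have [x xE] := to2_surj (k2 (Subg R2y)).
    have -> : y = (sgval (f x)).2 by rewrite fE /= h2E -xE k2K.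
    exact: (mem_proj2G (Subg (memR x))).
  move=> Ry; have [z /(congr1 sgval)/= ->] := @to2_surj R (Subg Ry).
  by have [x ->] := Rf z; rewrite fE /= h2E subgP.
subst R1 R2.
have memP (y : [subg R]) : (sgval (k1 (to1 y)), sgval (k2 (to2 y))) \in P.
  have [x yE] := Rf y.
  have -> : to1 y = h1 (to1 x) by apply: val_inj; rewrite /= yE fE /= h1E.
  have -> : to2 y = h2 (to2 x) by apply: val_inj; rewrite /= yE fE /= h2E.
  by rewrite h1K h2K /= -surjective_pairing subgP.
pose h : {ffun [subg P] -> [subg R]} := [ffun x => Subg (memR x)].
pose k : {ffun [subg R] -> [subg P]} := [ffun y => Subg (memP y)].
have hE x : sgval (h x) = (sgval (h1 (to1 x)), sgval (h2 (to2 x))).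
  by rewrite ffunE /= fE h1E h2E.
have kE y : sgval (k y) = (sgval (k1 (to1 y)), sgval (k2 (to2 y))).
  by rewrite ffunE.
exists h; last by move=> x; rewrite ffunE.
split; first by apply/prod_homP; split=> //; exists h1 => //; exists h2.
exists k; split.
- by apply/prod_homP; split=> //; exists k1 => //; exists k2.
- move=> x; apply: val_inj; rewrite /= kE.
  have -> : to1 (h x) = h1 (to1 x) by apply: val_inj; rewrite /= hE.
  have -> : to2 (h x) = h2 (to2 x) by apply: val_inj; rewrite /= hE.
  by rewrite h1K h2K /= -surjective_pairing.
- move=> y; apply: val_inj; rewrite /= hE.
  have -> : to1 (k y) = k1 (to1 y) by apply: val_inj; rewrite /= kE.
  have -> : to2 (k y) = k2 (to2 y) by apply: val_inj; rewrite /= kE.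
  by rewrite k1K k2K /= -surjective_pairing.
Qed.

Definition prod_fusion : fusion_system S :=
  FusionSystem prod_hom_obj prod_hom_morph prod_hom_inj prod_hom_comp
    prod_hom_conj prod_hom_fact.

End ProductFusion.

(* Main.v *)
Require Import Defs.
From mathcomp Require Import all_boot all_order all_algebra.
From mathcomp Require Import all_fingroup all_solvable all_field all_character.
From mathcomp Require Import mxtens.
From Stdlib Require Import Classical.

Set Implicit Arguments.
Unset Strict Implicit.
Unset Printing Implicit Defensive.

Import GroupScope GRing.Theory Num.Theory.

(* The value |det X_B|^2 is the determinant of the Gram matrix                *)
(*   (sum over classes of B_i(x) * conj (B_k(x)))_(i,k),                      *)
(* which does not depend on the Z-basis B.                                    *)
(*                                                                            *)
(* (1) When F is transitive, the trivial and the regular character form a     *)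
(* basis, and some nontrivial central element is fully centralised.           *)
(*                                                                            *)
(* (2) When F = F_S(G), extend stable class functions on S to G by 0 off the  *)
(* p-elements. The Gram matrix M of B for the inner product of G has          *)
(* determinant |det X_B|^2 / prod |C_G(x)|. Its inverse is integral: the dual *)
(* basis extends to class functions having integral inner products with the   *)
(* irreducible characters of G. Moreover |G : S| M has algebraic integer      *)
(* entries: for theta induced from the trivial character of S, the inner      *)
(* products of an extended stable character with the powers of theta are      *)
(* integers by Frobenius reciprocity, while by Euler's theorem some power of  *)
(* theta is 1 mod |S| on p-elements. So prod |C_G(x)| = m |det X_B|^2 with m  *)
(* prime to p. Finally |det X_B|^2 is a power of p: the stable characters     *)
(* form a saturated sublattice of the virtual characters of S, so |S| times   *)
(* the inverse of X_B is integral away from any given prime other than p.     *)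
(*                                                                            *)
(* (3) The lattice of F1 x F2 is the tensor product of those of F1 and F2, so *)
(* its Gram matrix is a Kronecker product. The ranks of the two factors are   *)
(* forced by that of the product.                                             *)

(** * Fusion classes *)

(** Passing to the Gram matrix makes the determinant independent of the basis ([det_gram_basis]).
    [prod_card_fccl] rewrites the right-hand side as the product over the classes of [max_cent]. So
    one convenient basis suffices, once its length is known to be the number of classes
    ([conjectureA_gram]).

    In the transitive case the basis consisting of 1 and the regular character gives 2|S|^2 - |S|^2
    = |S|^2, and both classes contain an element centralised by all of S.

    For [group_fusion], the orders |C_G(x)| are the inverse weights of the inner product of extended
    class functions ([p_ext_dotE]). Integrality of the inverse Gram matrix ([invmx_p_gram_int])
    gives k |det X|^2 = prod |C_G(x)| with k a positive integer. The primes are then separated: k is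
    prime to p because |G : S| clears the denominators of the Gram matrix ([p_ext_dot]), and only p
    can divide |det X|^2 ([prime_dvd_det_char_matrix]). Thus |det X|^2 is the p-part of prod
    |C_G(x)|, which [max_cent_Sylow] computes factor by factor.

    For products, classes, centralisers and lattices are all built from the two factors
    ([prod_fclassE], [max_cent_prod], [tens_basis_Zbasis]). The determinant of a Kronecker product
    ([gram_tens], [det_tensmx]) raises each factor's determinant to the rank of the other, which is
    how often each centraliser order occurs in the double product. *)

Section Classes.

Variables (gT : finGroupType) (S : {group gT}) (F : fusion_system S).

Lemma fclassP (x y : gT) :
  reflect (exists P Q : {group gT}, exists2 f : {ffun [subg P] -> [subg Q]},
             f \in fhom F P Q & exists2 z, sgval z = y & sgval (f z) = x)
          (y \in fclass F x).
Proof.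
rewrite inE; apply: (iffP andP) => [[_ /existsP[P /existsP[Q]]]|].
  case/exists_inP=> f fF /existsP[z /andP[/eqP zE /eqP fzE]].
  by exists P, Q, f => //; exists z.
case=> P [Q [f fF [z <- <-]]]; split.
  by have [sPS _] := fhom_obj fF; apply: (subsetP sPS); apply: subgP.
apply/existsP; exists P; apply/existsP; exists Q; apply/exists_inP.
by exists f => //; apply/existsP; exists z; rewrite !eqxx.
Qed.

Lemma fclass_mem x y : y \in fclass F x -> (x \in S) && (y \in S).
Proof.
case/fclassP=> P [Q [f fF [z <- <-]]]; have [sPS sQS] := fhom_obj fF.
by rewrite (subsetP sQS _ (subgP _)) (subsetP sPS _ (subgP _)).
Qed.

Lemma fclass_subset x : fclass F x \subset S.
Proof. by apply/subsetP=> y /fclass_mem/andP[]. Qed.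

Lemma fclass_conj x s : x \in S -> s \in S -> x \in fclass F (x ^ s).
Proof.
move=> Sx Ss; pose f : {ffun [subg S] -> [subg S]} :=
  [ffun y => subg S (sgval y ^ s)].
have fE y : sgval (f y) = sgval y ^ s by rewrite ffunE subgK ?groupJ ?subgP.
apply/fclassP; exists S, S, f.
  by apply: (@fhom_conj _ _ F _ _ _ s).
by exists (Subg Sx); rewrite ?fE.
Qed.

Lemma fclass_refl x : x \in S -> x \in fclass F x.
Proof. by move=> Sx; have := fclass_conj Sx (group1 S); rewrite conjg1. Qed.

(** By the axiom [fhom_fact], a morphism becomes invertible in the system once its target is cut
    down to its image. *)
Lemma fclass_sym x y : y \in fclass F x -> x \in fclass F y.
Proof.
case/fclassP=> P [Q [f fF [z <- <-]]].
have [R sRQ [h [hF [k [kF hK kK]]] hE]] := fhom_fact fF.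
apply/fclassP; exists R, P, k => //; exists (h z); first by rewrite hE.
by rewrite hK.
Qed.

Lemma fhom_incl (P Q : {group gT}) (f : {ffun [subg P] -> [subg Q]}) :
  P \subset Q -> Q \subset S -> (forall x, sgval (f x) = sgval x) ->
  f \in fhom F P Q.
Proof.
move=> sPQ sQS fE; apply: (@fhom_conj _ _ F _ _ _ 1) => //.
  exact: subset_trans sQS.
by move=> x; rewrite conjg1 fE.
Qed.

(** The two given morphisms need not compose, since the target of [g] may differ from the domain of
    [f]. Restricted to the cyclic group of [z], [g] is an isomorphism onto a group [R] generated by
    [y], and such an [R] lies in the domain of [f]. *)
Lemma fclass_trans x y z :
  y \in fclass F x -> z \in fclass F y -> z \in fclass F x.
Proof.
case/fclassP=> P [Q [f fF [u uE fuE]]] /fclassP[P' [Q' [g gF [v vE gvE]]]].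
have [sPS sQS] := fhom_obj fF; have [sP'S sQ'S] := fhom_obj gF.
have szP' : <[z]> \subset P' by rewrite cycle_subG -vE subgP.
pose i : {ffun [subg <[z]>] -> [subg P']} := [ffun t => subg P' (sgval t)].
have iE t : sgval (i t) = sgval t.
  by rewrite ffunE subgK // (subsetP szP') // subgP.
have iF : i \in fhom F <[z]>%G P' by apply: fhom_incl.
have giF := fhom_comp iF gF.
have [R sRQ [h [hF [k [kF hK kK]]] hE]] := fhom_fact giF.
have zE : sgval (Subg (cycle_id z)) = z by [].
have hz : sgval (h (Subg (cycle_id z))) = y.
  rewrite -hE ffunE -gvE; congr (sgval (g _)).
  by apply: val_inj; rewrite /= iE vE.
have sRP : R \subset P.
  apply/subsetP=> r Rr; rewrite -[r]/(sgval (Subg Rr)) -[Subg Rr]kK.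
  have /cycleP[n nE] := subgP (k (Subg Rr)).
  have -> : k (Subg Rr) = Subg (cycle_id z) ^+ n.
    by apply: val_inj; rewrite /= nE; elim: n {nE} => // m IHm; rewrite !expgS IHm.
  have hX m : sgval (h (Subg (cycle_id z) ^+ m)) = y ^+ m.
    elim: m => [|m IHm].
      apply: (mulgI (sgval (h 1))); rewrite mulg1.
      by have := congr1 sgval (fhom_morph hF 1 1); rewrite mulg1.
    by rewrite !expgS (fhom_morph hF) /= hz IHm.
  by rewrite hX groupX // -uE subgP.
pose j : {ffun [subg R] -> [subg P]} := [ffun t => subg P (sgval t)].
have jE t : sgval (j t) = sgval t.
  by rewrite ffunE subgK // (subsetP sRP) // subgP.
have jF : j \in fhom F R P by apply: fhom_incl.
have := fhom_comp (fhom_comp hF jF) fF => fjF.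
apply/fclassP; exists <[z]>%G, Q.
exists [ffun x => f ([ffun x => j (h x)] x)] => //.
exists (Subg (cycle_id z)) => //.
rewrite !ffunE -fuE; congr (sgval (f _)); apply: val_inj.
rewrite /= subgK ?hz ?uE //.
by rewrite -uE subgP.
Qed.

Lemma fclass_eq x y : y \in fclass F x -> fclass F y = fclass F x.
Proof.
move=> yx; apply/setP=> z; apply/idP/idP; first exact: fclass_trans.
exact/fclass_trans/fclass_sym.
Qed.

Lemma fcl_repr (C : {set gT}) : C \in fcl F -> repr C \in S /\ C = fclass F (repr C).
Proof.
case/imsetP=> x Sx ->; have xr := mem_repr x (fclass_refl Sx).
by rewrite (fclass_eq xr); split=> //; case/andP: (fclass_mem xr).
Qed.

Lemma mem_fcl x : x \in S -> fclass F x \in fcl F.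
Proof. exact: imset_f. Qed.

Lemma fcl_eq (C D : {set gT}) x :
  C \in fcl F -> D \in fcl F -> x \in C -> x \in D -> C = D.
Proof.
move=> /fcl_repr[_ ->] /fcl_repr[_ ->] xC xD.
by rewrite -(fclass_eq xC) (fclass_eq xD).
Qed.

Lemma mem_repr_fcl (C : {set gT}) : C \in fcl F -> repr C \in C.
Proof. by case/fcl_repr=> Sx {2}->; apply: fclass_refl. Qed.

Lemma fcl_subset (C : {set gT}) : C \in fcl F -> C \subset S.
Proof. by case/fcl_repr=> _ ->; apply: fclass_subset. Qed.

Lemma fcl_fclass (C : {set gT}) x : C \in fcl F -> x \in C -> C = fclass F x.
Proof. by case/fcl_repr=> _ -> xC; rewrite (fclass_eq xC). Qed.

(** A form of |C_S(x)|, for [x] fully centralised in [C], that involves no choice of [x]. *)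
Definition max_cent (C : {set gT}) := \max_(y in C) #|'C_S[y]|.

Lemma max_cent_fully (C : {set gT}) x :
  C \in fcl F -> x \in C -> fully_centralised F x -> max_cent C = #|'C_S[x]|.
Proof.
move=> FC xC /andP[_ /forall_inP xmax]; apply/eqP; rewrite eqn_leq.
rewrite (leq_bigmax_cond (F := fun y => #|'C_S[y]|)) // andbT.
by apply/bigmax_leqP=> y yC; apply: xmax; rewrite -(fcl_fclass FC xC).
Qed.

Lemma fully_centralised_fcl (C : {set gT}) :
  C \in fcl F -> exists2 x, x \in C & fully_centralised F x.
Proof.
move=> FC; have rC := mem_repr_fcl FC.
have /= := @arg_maxnP _ (repr C) (mem C) (fun y => #|'C_S[y]|) rC.
case=> x xC xmax; exists x => //; rewrite /fully_centralised.
rewrite (subsetP (fcl_subset FC)) //=; apply/forall_inP=> y.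
by rewrite -(fcl_fclass FC xC); apply: xmax.
Qed.

Lemma is_fcclP (X : {set gT}) :
  reflect ({in X, forall x, fully_centralised F x} /\
           forall C, C \in fcl F -> exists x, X :&: C = [set x])
          (is_fccl F X).
Proof.
apply: (iffP andP) => [[/forall_inP Xf /forall_inP XC]|[Xf XC]].
  by split=> // C /XC/cards1P.
split; apply/forall_inP=> // C /XC[x ->].
by rewrite cards1.
Qed.

Lemma is_fccl_exists : exists X, is_fccl F X.
Proof.
pose c (C : {set gT}) := odflt 1 [pick x in C | fully_centralised F x].
have cP C : C \in fcl F -> c C \in C /\ fully_centralised F (c C).
  move=> FC; rewrite /c; case: pickP => [x /andP[]|] //= no.
  have [x xC xf] := fully_centralised_fcl FC.
  by have := no x; rewrite /= xC xf.
exists (c @: fcl F); apply/is_fcclP; split.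
  by move=> _ /imsetP[C /cP[_ cf] ->].
move=> C FC; exists (c C); apply/setP=> x; rewrite !inE.
have [cC _] := cP C FC.
apply/andP/eqP => [[/imsetP[D FD ->] xC]|->]; last by rewrite imset_f.
by have [cD _] := cP D FD; rewrite (fcl_eq FC FD xC cD).
Qed.

Lemma big_fccl (X : {set gT}) (R : Type) (idx : R) (op : Monoid.com_law idx)
    (f : gT -> R) (g : {set gT} -> R) :
    is_fccl F X ->
    (forall C x, C \in fcl F -> x \in X -> x \in C -> f x = g C) ->
  \big[op/idx]_(x in X) f x = \big[op/idx]_(C in fcl F) g C.
Proof.
move=> /is_fcclP[Xf XC] fg.
have SX x : x \in X -> x \in S by move/Xf/andP=> [].
rewrite (partition_big (fun x => fclass F x) (mem (fcl F))) /=; last first.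
  by move=> x /SX; apply: mem_fcl.
apply: eq_bigr => C FC; have [x xE] := XC C FC.
have /setIP[Xx Cx] : x \in X :&: C by rewrite xE set11.
rewrite (big_pred1 x) ?(fg C x) // => y.
apply/andP/eqP => [[Xy /eqP yC]|->].
  by apply/set1P; rewrite -xE inE Xy -yC fclass_refl ?SX.
by rewrite -(fcl_fclass FC Cx).
Qed.

Lemma prod_card_fccl (X : {set gT}) : is_fccl F X ->
  (\prod_(x in X) #|'C_S[x]| = \prod_(C in fcl F) max_cent C)%N.
Proof.
move=> Xf; apply: big_fccl => // C x FC Xx Cx.
by case/is_fcclP: Xf => Xf _; rewrite (max_cent_fully FC Cx (Xf x Xx)).
Qed.

End Classes.

(** * Bases of lattices *)

Section Zbases.

Local Open Scope ring_scope.

Variables (V : zmodType) (R : {pred V}).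
Hypothesis R_closed : zmod_closed R.

Lemma Zbasis_sum_mem n (B : 'I_n -> V) (c : 'I_n -> int) :
  is_Zbasis R B -> \sum_i B i *~ c i \in R.
Proof.
case=> RB _; have R0 : 0 \in R by case: R_closed.
have RN : {in R, forall u, - u \in R}.
  by move=> u Ru; rewrite -sub0r; case: R_closed => _; apply.
have RD : {in R &, forall u v, u + v \in R}.
  move=> u v Ru Rv; rewrite -[v]opprK; case: R_closed => _; apply=> //.
  exact: RN.
have RM u (k : nat) : u \in R -> u *+ k \in R.
  by move=> Ru; elim: k => [|k IHk]; rewrite ?mulr0n // mulrS RD.
elim/big_ind: _ => // i _; case: (c i) => k; first exact: RM.
by rewrite NegzE mulrNz RN // RM.
Qed.

Lemma Zbasis_inj n (B : 'I_n -> V) (c d : 'I_n -> int) : is_Zbasis R B ->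
  \sum_i B i *~ c i = \sum_i B i *~ d i -> c =1 d.
Proof.
move=> basisB cd i; have RB := Zbasis_sum_mem c basisB.
case: basisB => _ /(_ _ RB)[e [eE e_uniq]].
have cE : e = finfun c.
  by apply: e_uniq; apply: eq_bigr => j _; rewrite ffunE.
have dE : e = finfun d.
  by apply: e_uniq; rewrite cd; apply: eq_bigr => j _; rewrite ffunE.
by have := congr1 (fun f : {ffun _} => f i) (esym cE); rewrite dE !ffunE.
Qed.

Lemma Zbasis_coord n (B : 'I_n -> V) v : is_Zbasis R B -> v \in R ->
  exists c : 'I_n -> int, v = \sum_i B i *~ c i.
Proof. by case=> _ RB /RB[c [-> _]]; exists c. Qed.

Lemma Zbasis_coord_mx m n (B : 'I_n -> V) (u : 'I_m -> V) : is_Zbasis R B ->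
  (forall i, u i \in R) ->
  exists U : 'M[int]_(m, n), forall i, u i = \sum_j B j *~ U i j.
Proof.
move=> basisB Ru; have /fin_all_exists[c cE] i := Zbasis_coord basisB (Ru i).
by exists (\matrix_(i, j) c i j) => i; rewrite cE; under [RHS]eq_bigr do rewrite mxE.
Qed.

Lemma Zbasis_change m n (B : 'I_m -> V) (B' : 'I_n -> V) :
    is_Zbasis R B -> is_Zbasis R B' ->
  exists U : 'M[int]_(m, n), (forall i, B i = \sum_j B' j *~ U i j) /\
    exists2 W : 'M[int]_(n, m), U *m W = 1%:M & W *m U = 1%:M.
Proof.
move=> basisB basisB'.
have [U UE] := Zbasis_coord_mx basisB' basisB.1.
have [W WE] := Zbasis_coord_mx basisB basisB'.1.
have comp p q (C : 'I_p -> V) (D : 'I_q -> V) (M : 'M_(p, q)) (N : 'M_(q, p)) :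
    is_Zbasis R C -> (forall i, C i = \sum_j D j *~ M i j) ->
    (forall i, D i = \sum_j C j *~ N i j) -> M *m N = 1%:M.
  move=> basisC CE DE; apply/matrixP=> i; apply: (Zbasis_inj basisC).
  rewrite [RHS](bigD1 i) //= [X in _ + X]big1 ?addr0 => [|j /negPf ji]; last first.
    by rewrite mxE eq_sym ji mulr0z.
  rewrite mxE eqxx mulr1z [RHS]CE; under [RHS]eq_bigr do rewrite DE mulrz_suml.
  rewrite exchange_big /=; apply: eq_bigr => k _.
  rewrite mxE mulrz_sumr; apply: eq_bigr => j _.
  by rewrite -mulrzA mulrC.
by exists U; split=> //; exists W; apply: comp; eassumption.
Qed.

Lemma Zbasis_card m n (B : 'I_m -> V) (B' : 'I_n -> V) :
  is_Zbasis R B -> is_Zbasis R B' -> m = n.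
Proof.
move=> basisB basisB'; have [U [_ [W UW WU]]] := Zbasis_change basisB basisB'.
by apply/eqP; rewrite eqn_leq (mulmx1_min UW) (mulmx1_min WU).
Qed.

End Zbases.

(** [P] is an arbitrary proposition, so the minimum comes from excluded middle. *)
Lemma ex_min_nat (P : nat -> Prop) :
  (exists n, P n) -> exists2 n, P n & forall m, P m -> (n <= m)%N.
Proof.
case=> n; elim/ltn_ind: n => n IHn Pn.
have [[m mn Pm]|noP] := classic (exists2 m, (m < n)%N & P m); first exact: IHn Pm.
exists n => // m Pm; rewrite leqNgt; apply/negP=> mn; apply: noP.
by exists m.
Qed.

(** * Subgroups of a free abelian group are free *)

Section ZbasisExists.

Local Open Scope ring_scope.

(** Induction on the number of coordinates: the kernel of the first coordinate has a basis, which is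
    completed, when that coordinate is not identically 0, by an element [w] whose first coordinate
    has least positive absolute value. *)
Lemma Zbasis_exists (V : zmodType) (N : nat) (co : 'I_N -> V -> int) (R : {pred V}) :
    zmod_closed R -> (forall i, {in R &, {morph co i : u v / u - v}}) ->
    (forall v, v \in R -> (forall i, co i v = 0) -> v = 0) ->
  exists n, exists B : 'I_n -> V, is_Zbasis R B.
Proof.
elim: N co R => [|N IHN] co R R_closed coB co_inj.
  have R0 v : v \in R -> v = 0 by move=> Rv; apply: co_inj => // -[].
  exists 0%N, (fun=> 0); split=> [[]|v Rv]//.
  exists [ffun=> 0]; split=> [|c _]; first by rewrite big_ord0 (R0 v).
  by apply/ffunP=> -[].
have [R0 RB] := R_closed.
pose R' := [pred v in R | co ord0 v == 0].
have co0 i : co i 0 = 0 by have := coB i 0 0 R0 R0; rewrite !subrr.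
have R'_closed : zmod_closed R'.
  split=> [|u v]; rewrite !inE ?R0 ?co0 //.
  by move=> /andP[Ru /eqP u0] /andP[Rv /eqP v0]; rewrite RB // coB // u0 v0.
have [||n [B basisB]] := IHN (fun i => co (lift ord0 i)) R' R'_closed.
- by move=> i u v /andP[Ru _] /andP[Rv _]; apply: coB.
- move=> v /andP[Rv /eqP v0] v0'; apply: co_inj => // i.
  by have [j ->|->] := unliftP ord0 i.
have [all0|] := classic (forall v, v \in R -> co ord0 v = 0).
  exists n, B; case: basisB => R'B coordB; split=> [i|v Rv].
    by case/andP: (R'B i).
  by apply: coordB; rewrite inE Rv all0.
move=> some_n0.
have [|d [w [Rw wd] d_gt0] dmin] :=
    @ex_min_nat (fun d => exists2 w, w \in R /\ `|co ord0 w|%N = d & (d > 0)%N).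
  apply: NNPP => no; apply: some_n0 => v Rv; apply/eqP/negPn/negP=> v0.
  by apply: no; exists `|co ord0 v|%N, v; rewrite ?absz_gt0.
have RN : {in R, forall u, - u \in R}.
  by move=> u Ru; rewrite -sub0r; apply: RB.
have RD u v : u \in R -> v \in R -> u + v \in R.
  by move=> Ru Rv; rewrite -[v]opprK RB ?RN.
have RM u k : u \in R -> u *~ k \in R.
  move=> Ru; have RMn (m : nat) : u *+ m \in R.
    by elim: m => [|m IHm]; rewrite ?mulr0n // mulrSr RD.
  by case: k => m; rewrite ?NegzE ?mulrNz ?RN //; apply: RMn.
have coN i u : u \in R -> co i (- u) = - co i u.
  by move=> Ru; rewrite -[in LHS]sub0r coB // co0 sub0r.
have coD i u v : u \in R -> v \in R -> co i (u + v) = co i u + co i v.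
  by move=> Ru Rv; rewrite -[in LHS](opprK v) coB ?RN // coN // opprK.
have coM i u k : u \in R -> co i (u *~ k) = co i u * k.
  move=> Ru; have coMn (m : nat) : co i (u *+ m) = co i u * m%:Z.
    elim: m => [|m IHm]; first by rewrite mulr0n co0 mulr0.
    by rewrite mulrSr coD ?IHm ?(RM u m) // intS mulrDr mulr1 addrC.
  case: k => m; first exact: coMn.
  by rewrite NegzE mulrNz coN ?mulrN ?coMn //; apply: (RM u m.+1).
have wN0 : co ord0 w != 0 by rewrite -absz_gt0 wd.
have w_div v : v \in R -> exists k, co ord0 v = co ord0 w * k.
  move=> Rv; exists (co ord0 v %/ co ord0 w)%Z.
  rewrite mulrC {1}(divz_eq (co ord0 v) (co ord0 w)).
  suff -> : (co ord0 v %% co ord0 w)%Z = 0 by rewrite addr0.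
  (* The Euclidean remainder is itself the first coordinate of a lattice element, so minimality of
     [w] forces it to be 0. *)
  pose r := v - w *~ (co ord0 v %/ co ord0 w)%Z.
  have Rr : r \in R by rewrite RB // RM.
  have rE : co ord0 r = (co ord0 v %% co ord0 w)%Z.
    by rewrite coB ?RM // coM // /modz mulrC.
  apply/eqP/negPn; rewrite -rE; apply/negP=> r0.
  have /dmin : exists2 w, w \in R /\ `|co ord0 w|%N = `|co ord0 r|%N & (`|co ord0 r| > 0)%N.
    by exists r; rewrite ?absz_gt0.
  rewrite leqNgt -wd => /negP; apply.
  rewrite -ltz_nat abszE ger0_norm rE ?modz_ge0 //.
  by rewrite abszE ltz_mod.
pose B1 (i : 'I_n.+1) := oapp B w (unlift ord0 i).
have B1sum (c : 'I_n.+1 -> int) : \sum_i B1 i *~ c i =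
    w *~ c ord0 + \sum_i B i *~ c (lift ord0 i).
  rewrite big_ord_recl /B1 unlift_none; congr (_ + _).
  by apply: eq_bigr => i _; rewrite liftK.
exists n.+1, B1; split=> [i|v Rv].
  rewrite /B1; case: unliftP => [j _|_] //=.
  by have [/(_ j)/andP[]] := basisB.
have R'v k : co ord0 v = co ord0 w * k -> v - w *~ k \in R'.
  by move=> vk; rewrite inE RB ?RM //= coB ?RM // coM // vk subrr.
have [k /[dup] vk /R'v/(Zbasis_coord basisB)[c cE]] := w_div v Rv.
have vE : v = w *~ k + \sum_i B i *~ c i by rewrite -cE addrC subrK.
exists [ffun i => oapp c k (unlift ord0 i)]; split.
  rewrite B1sum ffunE unlift_none /= {1}vE; congr (_ + _).
  by apply: eq_bigr => i _; rewrite ffunE liftK.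
move=> e; rewrite B1sum => eE.
have BR' := Zbasis_sum_mem R'_closed (fun i => e (lift ord0 i)) basisB.
have ek : e ord0 = k.
  apply: (mulfI wN0); rewrite -vk -coM // eE.
  by have /andP[RX /eqP X0] := BR'; rewrite coD ?RM // X0 addr0.
have ec : c =1 (fun i => e (lift ord0 i)).
  apply: (Zbasis_inj R'_closed basisB); apply: (addrI (w *~ k)).
  by rewrite -vE eE ek.
apply/ffunP=> i; rewrite ffunE; case: unliftP => [j ->|->] //=.
Qed.

End ZbasisExists.

(** * Stable virtual characters *)

Section StableCharacters.

Local Open Scope ring_scope.

Variables (gT : finGroupType) (S : {group gT}) (F : fusion_system S).

Lemma fstableP (phi : 'CF(S)) :
  reflect (forall x y, y \in fclass F x -> phi y = phi x) (fstable F phi).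
Proof.
apply: (iffP forall_inP) => [st x y yx|st x _].
  have /andP[Sx _] := fclass_mem yx.
  by have /forall_inP/(_ y yx)/eqP := st x Sx.
by apply/forall_inP=> y /st/eqP.
Qed.

Lemma stable_vcharE (phi : 'CF(S)) :
  (phi \in stable_vchar F) = (phi \in 'Z[irr S]) && fstable F phi.
Proof. by rewrite inE. Qed.

Lemma fstable_repr (phi : 'CF(S)) C x :
  fstable F phi -> C \in fcl F -> x \in C -> phi x = phi (repr C).
Proof.
move=> /fstableP st FC xC; have [_ CE] := fcl_repr FC.
by apply: st; rewrite -CE.
Qed.

Lemma fstable_inj (phi psi : 'CF(S)) : fstable F phi -> fstable F psi ->
  (forall C, C \in fcl F -> phi (repr C) = psi (repr C)) -> phi = psi.
Proof.
move=> st_phi st_psi eq_r; apply/cfun_inP=> x Sx.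
have FC := mem_fcl F Sx; have xC := fclass_refl F Sx.
by rewrite !(fstable_repr _ FC xC) ?eq_r.
Qed.

Lemma fstable_sumZ (I : finType) (f : I -> 'CF(S)) (a : I -> algC) :
  (forall i, fstable F (f i)) -> fstable F (\sum_i a i *: f i).
Proof.
move=> st; apply/fstableP=> x y yx; rewrite !sum_cfunE; apply: eq_bigr => i _.
by rewrite !cfunE; have /fstableP/(_ x y yx)-> := st i.
Qed.

Lemma stable_vchar_zmod : zmod_closed (stable_vchar F).
Proof.
split=> [|phi psi]; rewrite !stable_vcharE ?rpred0.
  by apply/fstableP=> x y _; rewrite !cfunE.
move=> /andP[Zphi /fstableP st_phi] /andP[Zpsi /fstableP st_psi].
rewrite rpredB //=; apply/fstableP=> x y yx.
by rewrite !cfunE (st_phi x y) ?(st_psi x y).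
Qed.

Lemma stable_vchar1 : 1 \in stable_vchar F.
Proof.
rewrite stable_vcharE cfun1_vchar; apply/fstableP=> x y yx.
by rewrite !cfun1E; have /andP[-> ->] := fclass_mem yx.
Qed.

Lemma stable_vcharM phi psi : phi \in stable_vchar F -> psi \in stable_vchar F ->
  phi * psi \in stable_vchar F.
Proof.
rewrite !stable_vcharE => /andP[Zphi /fstableP st_phi] /andP[Zpsi /fstableP st_psi].
rewrite mul_vchar //; apply/fstableP=> x y yx.
by rewrite !cfunE (st_phi x y) ?(st_psi x y).
Qed.

Lemma stable_vchar_conj phi :
  phi \in stable_vchar F -> (phi^*)%CF \in stable_vchar F.
Proof.
rewrite !stable_vcharE => /andP[Zphi /fstableP st_phi].
rewrite cfAut_vchar //; apply/fstableP=> x y yx.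
by rewrite !cfunE (st_phi x y).
Qed.

(** The coordinates are the multiplicities of the irreducible characters; they are already integers,
    and [Num.floor] only moves them into [int]. *)
Lemma stable_vchar_basis : exists n, exists B : 'I_n -> 'CF(S),
  is_Zbasis (stable_vchar F) B.
Proof.
pose co (i : Iirr S) (phi : 'CF(S)) := Num.floor '[phi, 'chi_i].
apply: (Zbasis_exists (co := co)) stable_vchar_zmod _ _.
  move=> i phi psi; rewrite !stable_vcharE => /andP[Zphi _] /andP[Zpsi _].
  apply: (@intr_inj algC); rewrite /co cfdotBl rmorphB /=.
  by rewrite !floorK ?rpredB ?Cint_cfdot_vchar_irr.
move=> phi; rewrite stable_vcharE => /andP[Zphi _] co0.
rewrite [phi]cfun_sum_cfdot big1 // => i _.
have := co0 i; rewrite /co => /(congr1 (intr : int -> algC)).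
by rewrite floorK ?Cint_cfdot_vchar_irr // => ->; rewrite scale0r.
Qed.

(** * Coordinates, evaluation and Gram matrix of a basis *)

Section Basis.

Variables (n : nat) (B : 'I_n -> 'CF(S)).
Hypothesis basisB : is_Zbasis (stable_vchar F) B.

Let B_vchar i : B i \in 'Z[irr S].
Proof. by have := basisB.1 i; rewrite stable_vcharE => /andP[]. Qed.

Let B_stable i : fstable F (B i).
Proof. by have := basisB.1 i; rewrite stable_vcharE => /andP[]. Qed.

Definition irr_coord : 'M[int]_(n, Nirr S) :=
  \matrix_(i, j) Num.floor '[B i, 'chi_j].

Lemma irr_coordE i j : (irr_coord i j)%:~R = '[B i, 'chi_j] :> algC.
Proof. by rewrite mxE floorK ?Cint_cfdot_vchar_irr ?B_vchar. Qed.

Lemma sum_irr_coord (v : 'rV[algC]_n) :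
  \sum_i v 0 i *: B i = \sum_j (v *m map_mx intr irr_coord) 0 j *: 'chi_j.
Proof.
transitivity (\sum_i \sum_j (v 0 i * (irr_coord i j)%:~R) *: 'chi[S]_j).
  apply: eq_bigr => i _; rewrite [in LHS](cfun_sum_cfdot (B i)) scaler_sumr.
  by apply: eq_bigr => j _; rewrite scalerA irr_coordE.
rewrite exchange_big; apply: eq_bigr => j _; rewrite -scaler_suml mxE.
by congr (_ *: _); apply: eq_bigr => i _; rewrite [in RHS]mxE.
Qed.

(* If v A = q w with v integral, then w is the coordinate vector of a virtual  *)
(* character that is stable since its q-fold is, so that q divides v.          *)
Lemma irr_coord_right_inverse_mod q : prime q ->
  exists T : 'M[int]_(Nirr S, n), ~~ (q %| \det (irr_coord *m T))%Z.
Proof.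
move=> q_pr; have qF := pchar_Fp q_pr.
have intrE (m : int) : (m%:~R == 0 :> 'F_q) = (q %| m)%Z by rewrite (dvdz_pcharf qF).
have liftE k l (M : 'M['F_q]_(k, l)) :
    map_mx intr (map_mx (fun x => (val x)%:Z) M) = M.
  by apply/matrixP=> i j; rewrite !mxE -pmulrn natr_Zp.
pose Aq : 'M['F_q]_(n, Nirr S) := map_mx intr irr_coord.
have /row_freeP[T AT] : row_free Aq.
  apply: inj_row_free => v vA.
  pose w : 'rV[int]_n := map_mx (fun x => (val x)%:Z) v.
  have wq j : exists k : int, (w *m irr_coord) 0 j = k * q%:Z.
    suff /dvdzP[k ->] : (q %| (w *m irr_coord) 0%R j)%Z by exists k.
    rewrite -intrE.
    have /matrixP/(_ 0 j) := vA; rewrite -[v]liftE -map_mxM mxE => ->.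
    by rewrite mxE.
  have [k kE] := fin_all_exists wq.
  pose psi := \sum_j 'chi[S]_j *~ k j.
  have wE : \sum_i B i *~ w 0 i = psi *~ q.
    transitivity (\sum_i (map_mx intr w) 0 i *: B i).
      by apply: eq_bigr => i _; rewrite [in RHS]mxE scaler_int.
    rewrite sum_irr_coord /psi mulrz_suml; apply: eq_bigr => j _.
    by rewrite -map_mxM mxE kE scaler_int mulrzA.
  have q0 : (q%:R : algC) != 0 by rewrite pnatr_eq0 -lt0n prime_gt0.
  have Rpsi : psi \in stable_vchar F.
    rewrite stable_vcharE; apply/andP; split.
      by apply: rpred_sum => j _; rewrite rpredMz ?irr_vchar.
    apply/fstableP=> x y yx; apply: (mulfI q0).
    have st: fstable F (psi *~ q).
      by rewrite -wE; have := Zbasis_sum_mem stable_vchar_zmod (w 0) basisB;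
         rewrite stable_vcharE => /andP[].
    by have /fstableP/(_ x y yx) := st; rewrite -scaler_int !cfunE.
  have [c cE] := Zbasis_coord basisB Rpsi.
  have wc i : w 0 i = c i * q.
    apply: (Zbasis_inj stable_vchar_zmod basisB (d := fun i => c i * q)).
    rewrite wE cE mulrz_suml; apply: eq_bigr => j _.
    by rewrite mulrzA.
  apply/rowP=> i; rewrite -[v]liftE mxE -/w wc mxE; apply/eqP.
  by rewrite intrE dvdz_mull.
exists (map_mx (fun x => (val x)%:Z) T).
by rewrite -intrE -det_map_mx map_mxM liftE AT det1 oner_eq0.
Qed.

(** Independence over the integers is upgraded to independence over the complex numbers. Any prime
    would do: for 2, the determinant of [irr_coord *m T] is odd, hence nonzero. *)
Lemma irr_coord_free (v : 'rV[algC]_n) : v *m map_mx intr irr_coord = 0 -> v = 0.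
Proof.
move=> vA; have [T] := irr_coord_right_inverse_mod (isT : prime 2).
set u := \det _ => u2.
have uU : (map_mx intr (irr_coord *m T) : 'M[algC]_n) \in unitmx.
  rewrite unitmxE det_map_mx unitfE intr_eq0 -/u.
  by apply: contraNneq u2 => ->; rewrite dvdz0.
by rewrite -[v](mulmxK uU) map_mxM mulmxA vA !mul0mx.
Qed.

(** Rectangular, because the length [n] of the basis is not assumed equal to the number of classes;
    in the square case this is [char_matrix]. *)
Definition eval_mx : 'M[algC]_(n, #|fcl F|) := \matrix_(i, j) B i (repr (enum_val j)).

(** A complex combination vanishing at one point of each class vanishes on S by stability, so its
    coordinates on the irreducible characters are 0. *)
Lemma eval_mx_free : row_free eval_mx.
Proof.
apply: inj_row_free => v vX; apply: irr_coord_free.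
have v0 : \sum_i v 0 i *: B i = 0.
  apply: fstable_inj => [||C FC]; first exact: fstable_sumZ.
    by apply/fstableP=> x y _; rewrite !cfunE.
  have /matrixP/(_ 0 (enum_rank_in FC C)) := vX; rewrite !mxE cfunE => <-.
  rewrite sum_cfunE; apply: eq_bigr => i _.
  by rewrite cfunE mxE enum_rankK_in.
apply/rowP=> j; rewrite [RHS]mxE; move/(congr1 (cfdot^~ 'chi_j)): v0.
by rewrite sum_irr_coord cfdot0l cfdot_suml (bigD1 j) //= big1 ?addr0
  => [|i /negPf ij]; rewrite cfdotZl cfdot_irr ?ij ?mulr0 ?eqxx ?mulr1.
Qed.

Lemma basis_card_le : (n <= #|fcl F|)%N.
Proof. by have := eval_mx_free; rewrite /row_free => /eqP <-; apply: rank_leq_col. Qed.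

Lemma basis_coord_uniq (a b : 'I_n -> algC) :
  \sum_i a i *: B i = \sum_i b i *: B i -> a =1 b.
Proof.
move=> ab i; pose v : 'rV_n := \row_i (a i - b i).
suff : v = 0 by move/rowP/(_ i); rewrite !mxE => /eqP; rewrite subr_eq0 => /eqP.
apply/eqP; rewrite -(mulmx_free_eq0 _ eval_mx_free); apply/eqP/rowP=> j.
rewrite !mxE; move/(congr1 (fun f : 'CF(S) => f (repr (enum_val j)))): ab.
rewrite !sum_cfunE => /eqP; rewrite -subr_eq0 -sumrB => /eqP {2}<-.
by apply: eq_bigr => k _; rewrite !mxE !cfunE mulrBl.
Qed.

Definition gram : 'M[algC]_n :=
  \matrix_(i, k) \sum_(C in fcl F) B i (repr C) * (B k (repr C))^*.

Lemma gramE : gram = eval_mx *m map_mx Num.Def.conjC eval_mx^T.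
Proof.
apply/matrixP=> i k; rewrite !mxE big_enum_val /=.
by apply: eq_bigr => j _; rewrite !mxE.
Qed.

End Basis.

Lemma det_gram_char_matrix (B : 'I_#|fcl F| -> 'CF(S)) :
  `|\det (char_matrix B)| ^+ 2 = \det (gram B).
Proof. by rewrite gramE det_mulmx det_map_mx det_tr normCK. Qed.

Lemma det_gram_basis m n (B : 'I_m -> 'CF(S)) (B' : 'I_n -> 'CF(S)) :
    is_Zbasis (stable_vchar F) B -> is_Zbasis (stable_vchar F) B' ->
  \det (gram B) = \det (gram B').
Proof.
move=> basisB basisB'.
have mn := Zbasis_card stable_vchar_zmod basisB basisB'; subst m.
have [U [UE [W UW _]]] := Zbasis_change stable_vchar_zmod basisB basisB'.
have XE : eval_mx B = map_mx intr U *m eval_mx B'.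
  apply/matrixP=> i j; rewrite !mxE UE sum_cfunE; apply: eq_bigr => k _.
  by rewrite -scaler_int !cfunE !mxE.
(* An invertible integer matrix has determinant 1 or -1. *)
have dU : \det U * \det U = 1.
  have : \det U * \det W = 1 by rewrite -det_mulmx UW det1.
  by rewrite mulrC => /intUnitRing.unitzPl; rewrite qualifE => /orP[]/eqP->.
have -> : gram B = map_mx intr U *m gram B' *m (map_mx intr U)^T.
  rewrite !gramE XE trmx_mul map_mxM !mulmxA; congr (_ *m _).
  by apply/matrixP=> i j; rewrite !mxE rmorph_int.
rewrite !det_mulmx det_tr det_map_mx mulrAC -rmorphM dU.
by rewrite rmorph1 mul1r.
Qed.

Lemma conjectureA_gram n (B : 'I_n -> 'CF(S)) (X : {set gT}) :
    is_Zbasis (stable_vchar F) B -> is_fccl F X -> n = #|fcl F| ->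
  conjectureA F <-> \det (gram B) = (\prod_(x in X) #|'C_S[x]|)%N%:R.
Proof.
move=> basisB XP nF; split=> [conjF|dB B' basisB' X' X'P].
  subst n; rewrite -det_gram_char_matrix; exact: conjF.
rewrite det_gram_char_matrix (det_gram_basis basisB' basisB) dB.
by rewrite (prod_card_fccl XP) (prod_card_fccl X'P).
Qed.

End StableCharacters.

(** * Transitive fusion systems *)

Section Transitive.

Local Open Scope ring_scope.

Lemma det_mx22 (R : comPzRingType) (A : 'M[R]_2) :
  \det A = A 0 0 * A 1 1 - A 0 1 * A 1 0.
Proof.
rewrite (expand_det_row _ 0) !big_ord_recl big_ord0 /cofactor !det_mx11 !mxE addr0.
rewrite expr0 expr1 mul1r mulN1r mulrN.
by congr (_ * A _ _ - A _ _ * A _ _); apply: val_inj.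
Qed.

Lemma fclass1 (gT : finGroupType) (S : {group gT}) (F : fusion_system S) :
  fclass F 1%g = [set 1%g].
Proof.
apply/setP=> y; apply/idP/set1P => [|->]; last exact: fclass_refl.
case/fclassP=> P [Q [f fF [z <- fz]]].
have f1 : f 1%g = 1%g.
  by apply: (mulgI (f 1%g)); rewrite mulg1 -(fhom_morph fF) mulg1.
by rewrite (fhom_inj fF (x1 := z) (x2 := 1%g)) // f1; apply: val_inj.
Qed.

(** There are |S : S'| linear characters, and S' is proper because S is nilpotent and nontrivial. *)
Lemma nontrivial_lin_char (gT : finGroupType) (S : {group gT}) (p : nat) :
  p.-group S -> S :!=: 1%g -> exists2 i : Iirr S, i != 0 & 'chi_i \is a linear_char.
Proof.
move=> pS ntS; have solS := nilpotent_sol (pgroup_nil pS).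
have lin_gt1 : (1 < #|[pred i : Iirr S | 'chi_i \is a linear_char]|)%N.
  by rewrite card_lin_irr indexg_gt1 proper_subn ?(sol_der1_proper solS).
have [i /andP[i0 lin_i]|no] :=
  pickP [pred i : Iirr S | (i != 0) && ('chi_i \is a linear_char)].
  by exists i.
suff : (#|[pred i : Iirr S | 'chi_i \is a linear_char]| <= #|pred1 (0%R : Iirr S)|)%N.
  by rewrite card1 leqNgt lin_gt1.
apply/subset_leq_card/subsetP=> i; rewrite !inE => lin_i.
by have := no i; rewrite /= lin_i andbT => /negbFE.
Qed.

Variables (gT : finGroupType) (S : {group gT}) (F : fusion_system S) (p : nat).

Theorem transitive_conjectureA :
  p.-group S -> #|fcl F| = 2 -> conjectureA F.
Proof.
move=> pS cl2.
have F1 : [set 1%g] \in fcl F by rewrite -(fclass1 F) mem_fcl.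
have [D [FD D1 FE]] : exists D, [/\ D \in fcl F, D != [set 1%g] & fcl F = [set [set 1%g]; D]].
  have [D DE] : exists D, fcl F :\ [set 1%g] = [set D].
    by apply/cards1P/eqP; move: cl2; rewrite (cardsD1 [set 1%g]) F1 add1n => -[].
  have /setD1P[D1 FD] : D \in fcl F :\ [set 1%g] by rewrite DE set11.
  by exists D; split=> //; rewrite -DE setD1K.
have nt1 : repr D != 1%g.
  apply: contraNneq D1 => rD; apply/eqP; apply: (fcl_eq (x := 1%g) FD F1).
    by rewrite -rD (mem_repr_fcl FD).
  exact: set11.
have SD := subsetP (fcl_subset FD) _ (mem_repr_fcl FD).
have inD x : x \in S -> x != 1%g -> x \in D.
  move=> Sx nt_x; have := mem_fcl F Sx; have xx := fclass_refl F Sx.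
  rewrite {1}FE => /set2P[] clx; rewrite clx // in xx.
  by rewrite inE (negPf nt_x) in xx.
have ntS : S :!=: 1%g by apply: contraNneq nt1 => S1; rewrite S1 inE in SD.
have [l l0 lin_l] := nontrivial_lin_char pS ntS.
have S0 : #|S|%:R != 0 :> algC by rewrite pnatr_eq0 -lt0n cardG_gt0.
pose B (i : 'I_2) : 'CF(S) := if i == 0 then 1 else cfReg S.
have sumB (c : 'I_2 -> int) : \sum_i B i *~ c i = (c 0)%:~R *: 1 + (c 1)%:~R *: cfReg S.
  rewrite !big_ord_recl big_ord0 addr0 !scaler_int /B /=.
  by congr (_ *~ c _ + _ *~ c _); apply: val_inj.
have Rreg : cfReg S \in stable_vchar F.
  rewrite stable_vcharE char_vchar ?cfReg_char //; apply/fstableP=> x y yx.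
  rewrite !cfRegE; suff -> : (y == 1%g) = (x == 1%g) by [].
  apply/eqP/eqP => E; move: yx.
    by rewrite E => /fclass_sym; rewrite fclass1 => /set1P.
  by rewrite E fclass1 => /set1P.
have valE (a c : algC) x : x \in S ->
    (a *: 1 + c *: cfReg S : 'CF(S)) x = a + c * (#|S|%:R *+ (x == 1%g)).
  by move=> Sx; rewrite -cfRegE cfunE ![(_ *: _ : 'CF(S)) x]cfunE cfun1E Sx mulr1.
have basisB : is_Zbasis (stable_vchar F) B.
  split=> [i|phi]; first by rewrite /B; case: ifP; rewrite ?stable_vchar1.
  rewrite stable_vcharE => /andP[Zphi st].
  (* All nontrivial elements lie in [D], so [phi] has the constant value [a] off the identity; a
     multiple of the regular character corrects the value at 1. *)
  pose a := phi (repr D); pose c := (phi 1%g - a) / #|S|%:R.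
  have phiE : phi = a *: 1 + c *: cfReg S.
    apply/cfun_inP=> x Sx; rewrite valE //.
    have [->|nt_x] := eqVneq x 1%g; first by rewrite mulr1n divfK // addrC subrK.
    by rewrite mulr0n mulr0 addr0 (fstable_repr st FD) ?inD.
  have reg_dot i : '[cfReg S, 'chi_i] = 'chi[S]_i 1%g.
    rewrite cfReg_sum cfdot_suml (bigD1 i) //= big1 ?addr0 => [|j /negPf ji].
      by rewrite cfdotZl cfdot_irr eqxx mulr1.
    by rewrite cfdotZl cfdot_irr ji mulr0.
  have phi_dot i : '[phi, 'chi_i] = a * '[1, 'chi_i] + c * 'chi_i 1%g.
    by rewrite {1}phiE cfdotDl ['[a *: _, _]]cfdotZl ['[c *: _, _]]cfdotZl reg_dot.
  (* Pairing [phi] with the nontrivial linear character [l] gives [c]; pairing it with the trivial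
     character gives [a + c]. *)
  have Zc : c \in Num.int.
    have := Cint_cfdot_vchar_irr l Zphi.
    rewrite phi_dot lin_char1 // -irr0 cfdot_irr eq_sym (negPf l0).
    by rewrite mulr0 mulr1 add0r.
  have Za : a \in Num.int.
    have := Cint_cfdot_vchar_irr 0 Zphi.
    rewrite phi_dot irr0 cfnorm1 cfun11 !mulr1.
    by move/(rpredB)/(_ Zc); rewrite addrK.
  exists [ffun i => if i == 0 then Num.floor a else Num.floor c]; split.
    by rewrite sumB !ffunE /= !floorK.
  move=> d; rewrite sumB => phid.
  have d0 : a = (d 0)%:~R.
    by rewrite /a phid valE // (negPf nt1) mulr0 addr0.
  have d1 : c = (d 1)%:~R.
    rewrite /c d0 phid valE // eqxx mulr1n addrAC subrr add0r.
    by rewrite mulfK.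
  apply/ffunP=> i; rewrite ffunE d0 d1 !intrKfloor.
  by case: i => [[|[|]]] //= ?; congr (d _); apply: val_inj.
have [X XF] := is_fccl_exists F.
apply/(conjectureA_gram basisB XF) => //.
have big_fcl (R : Type) (idx : R) (op : Monoid.com_law idx) (f : {set gT} -> R) :
    \big[op/idx]_(C in fcl F) f C = op (f [set 1%g]) (f D).
  by rewrite FE big_setU1 ?inE 1?eq_sym //= big_set1.
rewrite (prod_card_fccl XF) big_fcl /=.
have -> : max_cent S [set 1%g] = #|S|.
  by rewrite /max_cent big_set1 cent11T setIT.
have -> : max_cent S D = #|S|.
  apply/eqP; rewrite eqn_leq; apply/andP; split.
    by apply/bigmax_leqP=> x _; rewrite subset_leq_card ?subsetIl.
  have ntZ : 'Z(S) != 1%g by rewrite center_nil_eq1 ?(pgroup_nil pS).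
  have [z /setD1P[nt_z /setIP[Sz Cz]]] : exists z, z \in 'Z(S)^#.
    by apply/set0Pn; rewrite setD_eq0 subG1.
  apply: leq_trans (leq_bigmax_cond (F := fun y => #|'C_S[y]|) _ (inD z Sz nt_z)).
  by rewrite subset_leq_card // subsetI subxx sub_cent1.
(* The Gram matrix has rows (2, |S|) and (|S|, |S|^2). *)
rewrite det_mx22 !mxE !big_fcl /= repr_set1 /B /= !cfun11 !cfRegE eqxx (negPf nt1).
rewrite !cfun1E SD mulr1n mulr0n !rmorph0 !rmorph1 !rmorph_nat.
rewrite natrM !mul1r !mulr0 !mul0r !mulr1 !addr0.
by rewrite mulrDl mul1r addrK.
Qed.

End Transitive.

(** * Fusion systems of groups *)

Section GroupFusionClasses.

Variables (gT : finGroupType) (S G : {group gT}) (p : nat).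
Hypotheses (sSG : S \subset G) (sylS : p.-Sylow(G) S).

Let F := group_fusion sSG.
Let pS : p.-group S. Proof. exact: pHall_pgroup sylS. Qed.

Lemma group_fclassP x y :
  reflect [/\ x \in S, y \in S & x \in y ^: G] (y \in fclass F x).
Proof.
apply: (iffP idP) => [yx|[Sx Sy /imsetP[g Gg xE]]].
  have /andP[Sx Sy] := fclass_mem yx; split=> //.
  case/fclassP: yx => P [Q [f /group_homP[_ _ [g Gg fE]] [z <- <-]]].
  by rewrite fE memJ_class.
have syS : <[y]> \subset S by rewrite cycle_subG.
have sxS : <[x]> \subset S by rewrite cycle_subG.
have yxg : <[y]> :^ g = <[x]> by rewrite -cycleJ xE.
pose f : {ffun [subg <[y]>] -> [subg <[x]>]} :=
  [ffun z => subg <[x]>%G (sgval z ^ g)].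
have fE z : sgval (f z) = sgval z ^ g.
  by rewrite ffunE subgK //= -yxg memJ_conjg subgP.
apply/fclassP; exists <[y]>%G, <[x]>%G, f.
  by apply/group_homP; split=> //; exists g.
by exists (Subg (cycle_id y)); rewrite ?fE.
Qed.

(** The fusion class of [x] when [x] lies in S, but defined on all of G so that the p-elements of G
    can be sorted by it. *)
Definition Sylow_class x := (x ^: G) :&: S.

Lemma Sylow_classJ x g : g \in G -> Sylow_class (x ^ g) = Sylow_class x.
Proof. by move=> Gg; rewrite /Sylow_class classGidl. Qed.

Lemma fclass_Sylow_class x : x \in S -> fclass F x = Sylow_class x.
Proof.
move=> Sx; apply/setP=> y; apply/group_fclassP/setIP => [[_ Sy xy]|[yx Sy]].
  by rewrite class_sym.
by split=> //; rewrite class_sym.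
Qed.

Lemma p_elt_Sylow x : x \in G -> p.-elt x -> exists2 g, g \in G & x ^ g \in S.
Proof.
move=> Gx px; have sxG : <[x]> \subset G by rewrite cycle_subG.
have [g Gg sxS] := Sylow_Jsub sylS sxG px; exists g => //.
by apply: (subsetP sxS); rewrite memJ_conjg cycle_id.
Qed.

Lemma Sylow_class_fcl x : x \in G -> p.-elt x -> Sylow_class x \in fcl F.
Proof.
move=> Gx px; have [g Gg Sxg] := p_elt_Sylow Gx px.
by rewrite -(Sylow_classJ x Gg) -fclass_Sylow_class // mem_fcl.
Qed.

Lemma Sylow_class_eq C x : C \in fcl F ->
  [&& x \in G, p.-elt x & Sylow_class x == C] = (x \in repr C ^: G).
Proof.
move=> FC; have [Sr CE] := fcl_repr FC; have Gr := subsetP sSG _ Sr.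
apply/and3P/idP => [[Gx px /eqP xC]|/imsetP[g Gg ->]].
  have /setIP[] : repr C \in Sylow_class x by rewrite xC (mem_repr_fcl FC).
  by rewrite class_sym.
rewrite groupJ // p_eltJ (mem_p_elt pS Sr) Sylow_classJ //; split=> //.
by rewrite -fclass_Sylow_class // -CE.
Qed.

Lemma repr_Sylow_class x : x \in G -> p.-elt x ->
  repr (Sylow_class x) \in S /\ x \in repr (Sylow_class x) ^: G.
Proof.
move=> Gx px; have FC := Sylow_class_fcl Gx px.
by rewrite -Sylow_class_eq // Gx px eqxx; have [] := fcl_repr FC.
Qed.

(** A Sylow p-subgroup [P] of C_G(x) contains the central p-element x; a conjugation taking [P] into
    S takes x to a member of the class whose centraliser in S contains the conjugate of [P].
    Conversely, each C_S(y) is a p-subgroup of C_G(y), which has the order of C_G(x). *)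
Lemma max_cent_Sylow C : C \in fcl F -> max_cent S C = (#|'C_G[repr C]|`_p)%N.
Proof.
move=> FC; have [Sr CE] := fcl_repr FC; have Gr := subsetP sSG _ Sr.
set x := repr C in Sr CE Gr *.
apply/eqP; rewrite eqn_leq; apply/andP; split.
  apply/bigmax_leqP=> y; rewrite CE => /group_fclassP[_ Sy /imsetP[g Gg xE]].
  have -> : #|'C_G[x]| = #|'C_G[y]|.
    by rewrite -(cardJg 'C_G[y] g) conjIg -cent1J conjGid // -xE.
  rewrite dvdn_leq ?part_gt0 //.
  rewrite -[#|'C_S[y]|](part_pnat_id (pgroupS (subsetIl S _) pS)).
  by rewrite partn_dvd ?cardG_gt0 // cardSg // setSI.
have [P sylP] := Sylow_exists p 'C_G[x].
have [sPC pP _] := and3P sylP.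
have [sPG cPx] : P \subset G /\ P \subset 'C[x] by apply/andP; rewrite -subsetI.
have Px : x \in P.
  have xC : x \in 'C_G[x] by rewrite inE Gr cent1id.
  have nx : <[x]> <| 'C_G[x].
    by rewrite sub_center_normal // cycle_subG inE xC; apply/centP => z /setIP[_ /cent1P].
  have px : p.-group <[x]> by apply: mem_p_elt pS Sr.
  by rewrite -cycle_subG; apply: subset_trans (pcore_sub_Hall sylP); apply: pcore_max.
have [g Gg sPgS] := Sylow_Jsub sylS sPG pP.
have Sxg : x ^ g \in S by apply: (subsetP sPgS); rewrite memJ_conjg.
have Cxg : x ^ g \in C.
  rewrite CE; apply/group_fclassP; split=> //.
  by rewrite class_sym memJ_class.
rewrite -(card_Hall sylP) -(cardJg P g).
apply: leq_trans (leq_bigmax_cond (F := fun y => #|'C_S[y]|) _ Cxg).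
rewrite subset_leq_card // subsetI sPgS /=.
by rewrite cent1J conjSg.
Qed.

End GroupFusionClasses.

(** * Extension of class functions of a Sylow subgroup to the p-elements of G *)

Section SylowRestriction.

Local Open Scope ring_scope.

Variables (gT : finGroupType) (S G : {group gT}) (p : nat).
Hypotheses (p_pr : prime p) (sSG : S \subset G) (sylS : p.-Sylow(G) S).

Let F := group_fusion sSG.
Let pS : p.-group S. Proof. exact: pHall_pgroup sylS. Qed.
Local Notation cls := (Sylow_class S G).

(** Reading the value at the [repr] of the class of [x] gives a class function of G for every [phi];
    for stable [phi] it restricts to [phi] on S. *)
Definition p_ext_fun (phi : 'CF(S)) x : algC :=
  if (x \in G) && p.-elt x then phi (repr (cls x)) else 0.

Lemma p_ext_subproof phi : is_class_fun <<G>>%g [ffun x => p_ext_fun phi x].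
Proof.
rewrite genGid; apply: intro_class_fun => [x y Gx Gy|x /negPf Gx].
  by rewrite /p_ext_fun groupJ // Gx p_eltJ Sylow_classJ.
by rewrite /p_ext_fun Gx.
Qed.

Definition p_ext phi : 'CF(G) := Cfun 0 (p_ext_subproof phi).

Lemma p_extE phi x :
  p_ext phi x = if (x \in G) && p.-elt x then phi (repr (cls x)) else 0.
Proof. by rewrite cfunE. Qed.

Lemma p_ext_sum (I : finType) (a : I -> algC) (phi : I -> 'CF(S)) :
  p_ext (\sum_i a i *: phi i) = \sum_i a i *: p_ext (phi i).
Proof.
apply/cfunP=> x; rewrite sum_cfunE p_extE; case: ifP => [Gx|noGx].
  by rewrite sum_cfunE; apply: eq_bigr => i _; rewrite !cfunE /p_ext_fun Gx.
by rewrite big1 // => i _; rewrite cfunE p_extE noGx mulr0.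
Qed.

Lemma Res_p_ext phi : fstable F phi -> 'Res[S] (p_ext phi) = phi.
Proof.
move=> st; apply/cfun_inP=> x Sx; rewrite cfResE // p_extE.
rewrite (subsetP sSG) // (mem_p_elt pS Sx) -(fclass_Sylow_class sSG Sx).
by rewrite -(fstable_repr st (mem_fcl F Sx) (fclass_refl F Sx)).
Qed.

Lemma Res_stable (chi : 'CF(G)) : fstable F ('Res[S] chi).
Proof.
apply/fstableP=> x y /(group_fclassP sSG)[Sx Sy /imsetP[g Gg xE]].
by rewrite !cfResE // xE cfunJ.
Qed.

Lemma p_extM phi (chi : 'CF(G)) : p_ext (phi * 'Res[S] chi) = p_ext phi * chi.
Proof.
apply/cfunP=> x; rewrite !cfunE /p_ext_fun; case: ifP => [/andP[Gx px]|_].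
  have [Sr /imsetP[g Gg xE]] := repr_Sylow_class sSG sylS Gx px.
  by rewrite cfunE cfResE //; congr (_ * _); rewrite [in RHS]xE cfunJ.
by rewrite mul0r.
Qed.

(** Extending the restriction of [chi] multiplies [chi] by the indicator of the p-elements, off
    which [p_ext phi] is already 0. *)
Lemma p_ext_dot_Res phi (chi : 'CF(G)) :
  '[p_ext phi, chi] = '[p_ext phi, p_ext ('Res[S] chi)].
Proof.
have -> : p_ext ('Res[S] chi) = p_ext 1 * chi by rewrite -p_extM mul1r.
rewrite !cfdotE; congr (_ * _); apply: eq_bigr => x Gx.
rewrite [(_ * chi) x]cfunE !p_extE; case: ifP => [/andP[_ px]|_]; last by rewrite !mul0r.
have [Sr _] := repr_Sylow_class sSG sylS Gx px.
by rewrite cfun1E Sr mul1r.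
Qed.

(** The p-elements belonging to [C] form one G-class, of size |G : C_G(x)|; dividing by |G| leaves
    the weight 1/|C_G(x)|. *)
Lemma p_ext_dotE phi psi : '[p_ext phi, p_ext psi] =
  \sum_(C in fcl F) phi (repr C) * (psi (repr C))^* / #|'C_G[repr C]|%:R.
Proof.
rewrite cfdotE (bigID (fun x => p.-elt x)) /= [X in _ + X]big1 ?addr0; last first.
  by move=> x /andP[_ /negPf px]; rewrite p_extE px andbF mul0r.
rewrite (partition_big cls (mem (fcl F))) /=; last first.
  by move=> x /andP[Gx px]; apply: (Sylow_class_fcl sSG sylS).
rewrite mulr_sumr; apply: eq_bigr => C FC.
rewrite (eq_bigr (fun=> phi (repr C) * (psi (repr C))^*)); last first.
  by move=> x /andP[Gpx /eqP xC]; rewrite !p_extE Gpx xC.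
rewrite (eq_bigl (mem (repr C ^: G))); last first.
  by move=> x; rewrite -andbA (Sylow_class_eq sylS _ FC).
rewrite sumr_const -index_cent1; set t := phi _ * _.
rewrite -[t *+ _]mulr_natr mulrCA; congr (t * _).
rewrite -(Lagrange (subsetIl G 'C[repr C])) natrM invfM -mulrA mulVf ?mulr1 //.
by rewrite pnatr_eq0 -lt0n indexg_gt0.
Qed.

(* The value counts the cosets of S fixed by x; as x is a p-element it is      *)
(* congruent to |G : S| mod p.                                                 *)
Lemma Ind1_p_elt x : x \in G -> p.-elt x ->
  exists2 m, ('Ind[G] (1 : 'CF(S))) x = m%:R & ~~ (p %| m)%N.
Proof.
move=> Gx px; pose Fx := 'Fix_(rcosets S G | 'Rs)[x].
have fixE y : y \in G -> ((S :* y)%g \in Fx) = (x ^ y^-1 \in S)%g.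
  move=> Gy; rewrite !inE mem_rcosets mulSGid // Gy sub1set inE /= conjgE invgK.
  by rewrite rcosetE -rcosetM mulgA -mem_rcoset; apply/eqP/rcoset_eqP.
exists #|Fx|.
  rewrite cfIndE // (reindex_inj invg_inj) /=.
  rewrite (eq_bigl (mem G)) => [|y]; last by rewrite /= groupV.
  rewrite (bigID (fun y => (S :* y)%g \in Fx)) /= [X in _ + X]big1 ?addr0; last first.
    by move=> y /andP[Gy]; rewrite cfun1E fixE // => /negPf ->.
  rewrite (partition_big (fun y => S :* y)%g (mem Fx)) /=; last by move=> y /andP[].
  rewrite (eq_bigr (fun=> #|S|%:R)) => [|A AFx]; last first.
    have /setIP[/rcosetsP[y Gy AE] _] := AFx.
    rewrite (eq_bigr (fun=> 1)) => [|z /andP[/andP[Gz zF] _]]; last first.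
      by rewrite cfun1E -fixE // zF.
    rewrite sumr_const -(card_rcoset S y) -AE; congr (_%:R); apply: eq_card => z.
    rewrite unfold_in /=; apply/andP/idP => [[_ /eqP <-]|zA]; first exact: rcoset_refl.
    have SzA : (S :* z)%g = A by rewrite AE; apply: rcoset_eqP; rewrite -AE.
    rewrite SzA AFx eqxx andbT; split=> //.
    by move: zA; rewrite AE; apply/subsetP; rewrite mul_subG ?sub1set.
  by rewrite sumr_const -[#|S|%:R *+ _]mulr_natr mulKf // pnatr_eq0 -lt0n cardG_gt0.
have sxG : <[x]> \subset G by rewrite cycle_subG.
have acts := subset_trans sxG (actsRs_rcosets S G).
have /and3P[_ _] := sylS; rewrite p'natE // => pGS.
rewrite /dvdn; have := pgroup_fix_mod px acts; rewrite afix_cycle => <-.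
exact: pGS.
Qed.

Let theta := 'Ind[G] (1 : 'CF(S)).

(** One factor [theta] is used for Frobenius reciprocity; the other [k] are restricted to S and
    absorbed into the stable virtual character [phi]. *)
Lemma p_ext_dot_Ind1 phi k : phi \in stable_vchar F ->
  #|G|%:R^-1 * \sum_(x in G) p_ext phi x * theta x ^+ k.+1 \in Num.int.
Proof.
move=> Rphi.
have Rth : 'Res[S] theta \in stable_vchar F.
  by rewrite stable_vcharE Res_stable cfRes_vchar ?cfInd_vchar ?cfun1_vchar.
have Rk j : phi * 'Res[S] theta ^+ j \in stable_vchar F.
  elim: j => [|j IHj]; first by rewrite mulr1.
  by rewrite exprSr mulrA stable_vcharM.
have Zdot : '[phi * 'Res[S] theta ^+ k, 1] \in Num.int.
  by have := Rk k; rewrite stable_vcharE => /andP[? _]; rewrite Cint_cfdot_vchar ?cfun1_vchar.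
move: (Rk k) Zdot; rewrite stable_vcharE => /andP[_ /Res_p_ext {1}<-].
rewrite cfdot_Res_l cfdotE; congr (_ * _ \in Num.int); apply: eq_bigr => x Gx.
have -> : p_ext (phi * 'Res[S] theta ^+ k) = p_ext phi * theta ^+ k.
  by rewrite -rmorphXn p_extM.
rewrite -/theta [(p_ext phi * _) x]cfunE exp_cfunE // -mulrA p_extE.
case: ifP => [/andP[_ px]|_]; last by rewrite !mul0r.
by rewrite /theta; have [m -> _] := Ind1_p_elt Gx px; rewrite rmorph_nat exprSr.
Qed.

(** On p-elements the power of [theta] with exponent [totient #|S|] is 1 + |S|t. So replacing 1 by
    this power, which makes the inner product an integer, costs |S|/|G| times an algebraic integer,
    and |G : S| clears that denominator. *)
Lemma p_ext_dot1 phi : phi \in stable_vchar F ->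
  #|G : S|%:R * '[p_ext phi, 1] \in Aint.
Proof.
move=> Rphi; have Zphi : phi \in 'Z[irr S].
  by move: Rphi; rewrite stable_vcharE => /andP[].
have [k kE] : exists k, totient #|S| = k.+1.
  by exists (totient #|S|).-1; rewrite prednK // totient_gt0 cardG_gt0.
have [t tE] : exists t : gT -> nat, forall x, x \in G -> p.-elt x ->
    theta x ^+ k.+1 = 1 + #|S|%:R * (t x)%:R.
  suff /fin_all_exists[t tE] x : exists t : nat, x \in G -> p.-elt x ->
      theta x ^+ k.+1 = 1 + #|S|%:R * t%:R by exists t.
  have [/andP[Gx px]|no] := boolP ((x \in G) && p.-elt x); last first.
    by exists 0%N => Gx px; rewrite Gx px in no.
  have [m thE pm] := Ind1_p_elt Gx px.
  have m_gt0 : (0 < m)%N by case: (m) pm; rewrite ?dvdn0.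
  have cop : coprime m #|S|.
    by rewrite coprime_sym (pnat_coprime pS) // p'natE.
  have /eqP := Euler_exp_totient cop; rewrite kE.
  rewrite eqn_mod_dvd ?expn_gt0 ?m_gt0 // => /dvdnP[t tE].
  exists t => _ _; rewrite /theta thE -natrX -natrM -(natrD _ 1%N) mulnC -tE.
  by rewrite subnKC ?expn_gt0 ?m_gt0.
pose A := \sum_(x in G) p_ext phi x * (t x)%:R.
have AA : A \in Aint.
  apply: rpred_sum => x _; rewrite rpredM ?rpred_nat // p_extE.
  by case: ifP => _; rewrite ?rpred0 ?Aint_vchar.
have := p_ext_dot_Ind1 k Rphi; set z := _ * _ => Zz.
suff -> : #|G : S|%:R * '[p_ext phi, 1] = #|G : S|%:R * z - A.
  by rewrite rpredB // rpredM ?rpred_nat ?Aint_Cint.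
have zE : z = '[p_ext phi, 1] + #|G|%:R^-1 * (#|S|%:R * A).
  rewrite cfdotE -mulrDr mulr_sumr -big_split; congr (_ * _).
  apply: eq_bigr => x Gx; rewrite cfun1E Gx rmorph1 mulr1 p_extE.
  case: ifP => [/andP[_ px]|_] /=; last by rewrite !mul0r mulr0 addr0.
  by rewrite tE // mulrDr mulr1 mulrCA.
rewrite zE mulrDr -addrA [X in _ + X](_ : _ = 0) ?addr0 //.
rewrite mulrCA [X in _ * X]mulrA -natrM mulnC Lagrange // mulKf ?subrr //.
by rewrite pnatr_eq0 -lt0n cardG_gt0.
Qed.

(** This is [p_ext_dot1] for the product of [phi] with the conjugate of [psi]. *)
Lemma p_ext_dot phi psi : phi \in stable_vchar F -> psi \in stable_vchar F ->
  #|G : S|%:R * '[p_ext phi, p_ext psi] \in Aint.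
Proof.
move=> Rphi Rpsi; have := p_ext_dot1 (stable_vcharM Rphi (stable_vchar_conj Rpsi)).
congr (_ * _ \in Aint); rewrite !cfdotE; congr (_ * _); apply: eq_bigr => x Gx.
rewrite cfun1E Gx rmorph1 mulr1 !p_extE; case: ifP => _; last by rewrite mul0r.
by rewrite !cfunE.
Qed.

End SylowRestriction.

(** * Primes dividing the squared determinant *)

Section DeterminantPrimes.

Local Open Scope ring_scope.

Lemma Aint_det n (M : 'M[algC]_n) : (forall i j, M i j \in Aint) -> \det M \in Aint.
Proof.
by move=> MA; apply: rpred_sum => s _; rewrite rpredMsign rpred_prod.
Qed.

Variables (gT : finGroupType) (S : {group gT}) (F : fusion_system S).
Variable B : 'I_#|fcl F| -> 'CF(S).
Hypothesis basisB : is_Zbasis (stable_vchar F) B.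

Let B_stable i : fstable F (B i).
Proof. by have := basisB.1 i; rewrite stable_vcharE => /andP[]. Qed.

Lemma char_matrix_unit : char_matrix B \in unitmx.
Proof. by rewrite -row_free_unit; exact: eval_mx_free basisB. Qed.

Lemma char_matrix_Aint i j : char_matrix B i j \in Aint.
Proof.
rewrite mxE; have := basisB.1 i; rewrite stable_vcharE => /andP[Zb _].
exact: Aint_vchar.
Qed.

Lemma sqr_det_char_matrix_Aint : `|\det (char_matrix B)| ^+ 2 \in Aint.
Proof.
rewrite normCK rpredM ?Aint_aut // Aint_det // => i j; exact: char_matrix_Aint.
Qed.

(** With C = |S| X^-1 and A the matrix of multiplicities, C A has algebraic integer entries, and A
    has a right inverse [T] up to a determinant [u] prime to q. For e = det(C A T) this gives |e|^2
    d = u^2 |S|^(2n) with n the number of classes and |e|^2 an integer, so q divides |S|. *)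
Lemma prime_dvd_det_char_matrix q d : prime q -> (q %| d)%N ->
  `|\det (char_matrix B)| ^+ 2 = d%:R -> (q %| #|S|)%N.
Proof.
move=> q_pr qd detB; have Xu := char_matrix_unit.
set X := char_matrix B in detB Xu.
have S0 : #|S|%:R != 0 :> algC by rewrite pnatr_eq0 -lt0n cardG_gt0.
pose C := #|S|%:R *: invmx X.
have CX : C *m X = #|S|%:R%:M by rewrite -scalemxAl mulVmx // scalemx1.
pose A : 'M[algC]_(_, _) := map_mx intr (irr_coord B).
have CA j k : (C *m A) j k \in Aint.
  (* [g] is |S| times the indicator of the [j]-th class, so its inner products with irreducible
     characters are sums of character values. *)
  pose g := \sum_i (row j C) 0 i *: B i.
  have st : fstable F g by apply: fstable_sumZ.
  have gE x : x \in S -> g x = #|S|%:R *+ (x \in (enum_val j : {set gT})).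
    move=> Sx; have FC := mem_fcl F Sx; have xC := fclass_refl F Sx.
    rewrite (fstable_repr st FC xC).
    transitivity ((C *m X) j (enum_rank_in FC (fclass F x))).
      rewrite sum_cfunE mxE; apply: eq_bigr => i _.
      by rewrite cfunE !mxE enum_rankK_in.
    rewrite CX mxE; congr (_ *+ _); congr nat_of_bool; apply/eqP/idP => [->|xj].
      by rewrite enum_rankK_in.
    by apply: enum_val_inj; rewrite enum_rankK_in // (fcl_fclass (enum_valP j) xj).
  have -> : (C *m A) j k = '[g, 'chi_k].
    rewrite /g (sum_irr_coord basisB) -row_mul cfdot_suml (bigD1 k) //= big1 => [|i /negPf ik].
      by rewrite addr0 cfdotZl cfnorm_irr mulr1 [RHS]mxE.
    by rewrite cfdotZl cfdot_irr ik mulr0.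
  rewrite cfdotE mulr_sumr; apply: rpred_sum => x Sx; rewrite gE //.
  case: (x \in _); last by rewrite mul0r mulr0 rpred0.
  by rewrite mulr1n mulKf // Aint_aut Aint_irr.
have [T] := irr_coord_right_inverse_mod basisB q_pr; set u := \det _ => qu.
pose e := \det (C *m A *m map_mx intr T).
have Ae : e \in Aint.
  apply: Aint_det => i j; rewrite mxE; apply: rpred_sum => k _.
  by rewrite rpredM // mxE Aint_int.
have eX : e * \det X = u%:~R * #|S|%:R ^+ #|fcl F|.
  rewrite /e -mulmxA -map_mxM det_mulmx det_map_mx -/u mulrAC -det_mulmx CX.
  by rewrite det_scalar mulrC.
have d0 : d%:R != 0 :> algC.
  by rewrite -detB expf_neq0 // normr_eq0 -unitfE -unitmxE.
have Ed : `|e| ^+ 2 * d%:R = (`|u|%N ^ 2 * (#|S| ^ #|fcl F|) ^ 2)%:R.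
  rewrite -detB -exprMn -normrM eX normrM exprMn natrM !natrX.
  by rewrite normrX normr_nat -intr_norm -abszE.
(* Rational by [Ed], and an algebraic integer, hence an integer. *)
have [E EE] : exists E : nat, `|e| ^+ 2 = E%:R.
  apply/natrP; rewrite natrEint exprn_ge0 // andbT Cint_rat_Aint //.
    have -> : `|e| ^+ 2 = (`|u|%N ^ 2 * (#|S| ^ #|fcl F|) ^ 2)%:R / d%:R.
      by rewrite -Ed mulfK.
    by rewrite rpred_div ?rpred_nat.
  by rewrite normCK rpredM // Aint_aut.
move: Ed; rewrite EE -natrM => /eqP; rewrite eqr_nat => /eqP Ed.
have : (q %| `|u|%N ^ 2 * (#|S| ^ #|fcl F|) ^ 2)%N by rewrite -Ed dvdn_mull.
rewrite Euclid_dvdM // !Euclid_dvdX //= !andbT => /orP[qu'|/andP[]//].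
by case/negP: qu.
Qed.

End DeterminantPrimes.

Lemma partn_prod (I : Type) (r : seq I) (P : pred I) (f : I -> nat) (pi : nat_pred) :
  (forall i, 0 < f i)%N ->
  ((\prod_(i <- r | P i) f i)`_pi = \prod_(i <- r | P i) (f i)`_pi)%N.
Proof.
move=> f_gt0; elim: r => [|i r IHr]; first by rewrite !big_nil partn1.
by rewrite !big_cons; case: (P i); rewrite // partnM ?IHr ?prodn_gt0.
Qed.

(** * The determinant for the fusion system of a group *)

Section SylowFusion.

Local Open Scope ring_scope.

Variables (gT : finGroupType) (S G : {group gT}) (p : nat).
Hypotheses (p_pr : prime p) (sSG : S \subset G) (sylS : p.-Sylow(G) S).

Let F := group_fusion sSG.
Let pS : p.-group S. Proof. exact: pHall_pgroup sylS. Qed.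
Local Notation ext := (@p_ext gT S G p).

Section Basis.

Variable B : 'I_#|fcl F| -> 'CF(S).
Hypothesis basisB : is_Zbasis (stable_vchar F) B.

Let X := char_matrix B.

Definition p_gram : 'M[algC]_#|fcl F| := \matrix_(i, k) '[ext (B i), ext (B k)].

Let cent_prod := (\prod_(C in fcl F) #|'C_G[repr C]|)%N.

Lemma cent_prod_gt0 : (0 < cent_prod)%N.
Proof. by apply: prodn_gt0 => C; apply: cardG_gt0. Qed.

Lemma det_p_gram : \det p_gram = `|\det X| ^+ 2 / cent_prod%:R.
Proof.
pose w : 'rV[algC]_#|fcl F| := \row_j #|'C_G[repr (enum_val j)]|%:R^-1.
have -> : p_gram = X *m diag_mx w *m map_mx Num.Def.conjC X^T.
  apply/matrixP=> i k; rewrite mxE (p_ext_dotE sSG sylS) big_enum_val mxE.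
  by apply: eq_bigr => j _; rewrite mul_mx_diag !mxE /= mulrAC.
rewrite !det_mulmx det_diag det_map_mx det_tr normCK mulrAC; congr (_ * _).
rewrite /cent_prod natr_prod -prodfV [RHS]big_enum_val.
by apply: eq_bigr => j _; rewrite mxE.
Qed.

Lemma p_gram_unit : p_gram \in unitmx.
Proof.
rewrite unitmxE unitfE det_p_gram mulf_neq0 //.
  by rewrite expf_neq0 // normr_eq0 -unitfE -unitmxE (char_matrix_unit basisB).
by rewrite invr_eq0 pnatr_eq0 -lt0n cent_prod_gt0.
Qed.

(** Row [j] of the inverse holds the coordinates of the dual [h] of [B j]. Pairing [ext h] with an
    irreducible character of G reads off an integral coordinate of its restriction to S; so [ext h]
    is a virtual character of G, and [h], its restriction, lies in the lattice. *)
Lemma invmx_p_gram_int j k : invmx p_gram j k \in Num.int.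
Proof.
have B_stable i : fstable F (B i).
  by have := basisB.1 i; rewrite stable_vcharE => /andP[].
pose P := invmx p_gram; pose h := \sum_i P j i *: B i.
have st_h : fstable F h by apply: fstable_sumZ.
have h_dual i : '[ext h, ext (B i)] = (j == i)%:R.
  transitivity ((P *m p_gram) j i); last by rewrite mulVmx ?p_gram_unit // mxE.
  rewrite p_ext_sum cfdot_suml mxE; apply: eq_bigr => l _.
  by rewrite cfdotZl [p_gram _ _]mxE.
have Zext : ext h \in 'Z[irr G].
  rewrite [ext h]cfun_sum_cfdot; apply: rpred_sum => l _.
  rewrite scale_zchar ?irr_vchar //.
  have RB : 'Res[S] 'chi[G]_l \in stable_vchar F.
    by rewrite stable_vcharE (Res_stable sSG) cfRes_vchar ?irr_vchar.
  have [c cE] := Zbasis_coord basisB RB.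
  have {}cE : 'Res[S] 'chi[G]_l = \sum_i (c i)%:~R *: B i.
    by rewrite cE; apply: eq_bigr => i _; rewrite scaler_int.
  rewrite (p_ext_dot_Res sSG sylS) cE (p_ext_sum _ _ (fun i => (c i)%:~R)) cfdot_sumr; apply: rpred_sum => i _.
  by rewrite cfdotZr h_dual rpredM ?rpred_nat // conj_intr ?intr_int.
have Rh : h \in stable_vchar F.
  by rewrite stable_vcharE st_h -(Res_p_ext sylS st_h) cfRes_vchar.
have [c cE] := Zbasis_coord basisB Rh.
have -> : invmx p_gram j k = (c k)%:~R; last exact: intr_int.
apply: (basis_coord_uniq basisB (a := P j) (b := fun i => (c i)%:~R)).
rewrite -/h cE; apply: eq_bigr => i _; by rewrite scaler_int.
Qed.

Lemma group_det_char_matrix : `|\det X| ^+ 2 = (\prod_(C in fcl F) max_cent S C)%N%:R.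
Proof.
have [m mE] : exists m : int, \det (invmx p_gram) = m%:~R.
  apply/intrP; pose Pz : 'M[int]_#|fcl F| := map_mx Num.floor (invmx p_gram).
  have -> : invmx p_gram = map_mx intr Pz.
    by apply/matrixP=> i j; rewrite !mxE floorK // invmx_p_gram_int.
  by rewrite det_map_mx intr_int.
have cp0 : cent_prod%:R != 0 :> algC by rewrite pnatr_eq0 -lt0n cent_prod_gt0.
have dX0 : `|\det X| ^+ 2 != 0.
  by rewrite expf_neq0 // normr_eq0 -unitfE -unitmxE (char_matrix_unit basisB).
have mD : m%:~R * `|\det X| ^+ 2 = cent_prod%:R.
  by rewrite -mE det_inv det_p_gram invf_div divfK.
have m0 : m%:~R != 0 :> algC by apply: contra_neq cp0 => m0; rewrite -mD m0 mul0r.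
have [d dE] : exists d : nat, `|\det X| ^+ 2 = d%:R.
  apply/natrP; rewrite natrEint exprn_ge0 // andbT Cint_rat_Aint //.
    have -> : `|\det X| ^+ 2 = cent_prod%:R / m%:~R by rewrite -mD mulrAC mulfV ?mul1r.
    by rewrite rpred_div ?rpred_nat ?rpred_int.
  exact: sqr_det_char_matrix_Aint basisB.
have d_gt0 : (0 < d)%N by rewrite lt0n -(pnatr_eq0 algC) -dE.
(* A negative [m] would make the positive integer [cent_prod] negative. *)
have [k mk] : exists k : nat, m = k.
  case: m {mE m0} mD => k; first by exists k.
  rewrite dE NegzE => /eqP; rewrite mulrNz mulNr eq_sym -subr_eq0 opprK.
  by rewrite -natrM -natrD pnatr_eq0 addn_eq0 (negPf (lt0n_neq0 cent_prod_gt0)).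
have k_gt0 : (0 < k)%N by rewrite lt0n; apply: contra_neq m0 => k0; rewrite mk k0.
have kd : (k * d = cent_prod)%N.
  by apply/eqP; rewrite -(eqr_nat algC) natrM -dE -mD mk.
have pd : p.-nat d.
  apply/pnatP => // q q_pr qd.
  have := prime_dvd_det_char_matrix basisB q_pr qd dE.
  by apply: (pnatP _ _ pS).
have pk : p^'.-nat k.
  (* This quotient is the determinant of |G : S| times the Gram matrix; being rational it is an
     integer, so [k] divides a power of |G : S|. *)
  have AM : (#|G : S| ^ #|fcl F|)%:R / k%:R \in Aint.
    have -> : (#|G : S| ^ #|fcl F|)%:R / k%:R = \det (#|G : S|%:R *: p_gram).
      rewrite detZ natrX; congr (_ * _).
      by rewrite -[p_gram]invmxK det_inv mE mk.
    by apply: Aint_det => i j; rewrite !mxE (p_ext_dot p_pr sylS) // basisB.1.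
  have : (k %| #|G : S| ^ #|fcl F|)%N.
    have /intrP[z zE] : ((#|G : S| ^ #|fcl F|)%:R / k%:R : algC) \in Num.int.
      by rewrite Cint_rat_Aint // rpred_div ?rpred_nat.
    have : (#|G : S| ^ #|fcl F|)%:Z = z * k.
      apply: (@intr_inj algC); rewrite intrM -zE divfK //.
      by rewrite pnatr_eq0 -lt0n.
    by move/(congr1 absz); rewrite abszM /= => ->; rewrite dvdn_mull.
  move/pnat_dvd; apply; rewrite pnatX; apply/orP; left.
  by case/and3P: sylS.
have -> : `|\det X| ^+ 2 = (cent_prod`_p)%N%:R.
  by rewrite -kd partnM // part_p'nat // mul1n part_pnat_id.
congr (_%:R); rewrite /cent_prod; rewrite partn_prod => [|C]; last exact: cardG_gt0.
by apply: eq_bigr => C FC; rewrite (max_cent_Sylow sylS FC).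
Qed.

End Basis.

Theorem group_conjectureA : conjectureA F.
Proof.
move=> B basisB X XF.
by rewrite (group_det_char_matrix basisB) (prod_card_fccl XF).
Qed.

End SylowFusion.

(** * Products of fusion systems *)

Lemma in_setXE (T1 T2 : finType) (A : {set T1}) (B : {set T2}) x :
  (x \in setX A B) = (x.1 \in A) && (x.2 \in B).
Proof. by case: x => x1 x2; rewrite in_setX. Qed.

Section ProductClasses.

Variables (gT1 gT2 : finGroupType) (S1 : {group gT1}) (S2 : {group gT2}).
Variables (F1 : fusion_system S1) (F2 : fusion_system S2).

Let F := prod_fusion F1 F2.

(** Transports a morphism along group equalities that hold only propositionally, such as that of
    [P1] with the first projection of its product with [P2]. *)
Lemma fhom_cast (gT : finGroupType) (S : {group gT}) (K : fusion_system S)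
    (P Q P' Q' : {group gT}) (f : {ffun [subg P] -> [subg Q]}) :
    P = P' -> Q = Q' -> f \in fhom K P Q ->
  exists2 f' : {ffun [subg P'] -> [subg Q']}, f' \in fhom K P' Q' &
    forall t, sgval (f' t) = sgval (f (subg P (sgval t))).
Proof. by move=> <- <- fK; exists f => // t; rewrite sgvalK. Qed.

Lemma prod_fclassE x :
  fclass F x = setX (fclass F1 x.1) (fclass F2 x.2).
Proof.
apply/setP=> y; rewrite in_setXE; apply/idP/andP.
  case/fclassP=> P [Q [f /prod_homP[_ _ [f1 f1F [f2 f2F fE]]] [z <- <-]]].
  rewrite fE; split; apply/fclassP.
    by exists (proj1G P), (proj1G Q), f1 => //; exists (to1 z).
  by exists (proj2G P), (proj2G Q), f2 => //; exists (to2 z).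
case=> /fclassP[P1 [Q1 [f1 f1F [z1 z1E f1z]]]] /fclassP[P2 [Q2 [f2 f2F [z2 z2E f2z]]]].
have [sP1 sQ1] := fhom_obj f1F; have [sP2 sQ2] := fhom_obj f2F.
pose P := setX_group P1 P2; pose Q := setX_group Q1 Q2.
have P1E : P1 = proj1G P by apply: val_inj; rewrite /= morphim_fstX.
have Q1E : Q1 = proj1G Q by apply: val_inj; rewrite /= morphim_fstX.
have P2E : P2 = proj2G P by apply: val_inj; rewrite /= morphim_sndX.
have Q2E : Q2 = proj2G Q by apply: val_inj; rewrite /= morphim_sndX.
have [h1 h1F h1E] := fhom_cast P1E Q1E f1F.
have [h2 h2F h2E] := fhom_cast P2E Q2E f2F.
pose f : {ffun [subg P] -> [subg Q]} :=
  [ffun t => subg Q (sgval (h1 (to1 t)), sgval (h2 (to2 t)))].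
have fE t : sgval (f t) = (sgval (h1 (to1 t)), sgval (h2 (to2 t))).
  by rewrite ffunE subgK //= in_setXE /= h1E h2E !subgP.
have Py : y \in P by rewrite inE /= -z1E -z2E !subgP.
apply/fclassP; exists P, Q, f.
  apply/prod_homP; split; [exact: setXS | exact: setXS | exists h1 => //].
  by exists h2.
exists (Subg Py) => //; rewrite fE h1E h2E /= -z1E -z2E !sgvalK f1z f2z.
by rewrite -surjective_pairing.
Qed.

Lemma big_prod_fcl (R : Type) (idx : R) (op : Monoid.com_law idx)
    (f : {set gT1 * gT2} -> R) :
  \big[op/idx]_(C in fcl F) f C =
  \big[op/idx]_(C1 in fcl F1) \big[op/idx]_(C2 in fcl F2) f (setX C1 C2).
Proof.
have fclE : fcl F =
    [set setX u.1 u.2 | u in setX (fcl F1) (fcl F2)].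
  apply/setP=> C; apply/imsetP/imsetP => [[x Sx ->]|[u]].
    move: Sx; rewrite inE => /andP[Sx1 Sx2].
    exists (fclass F1 x.1, fclass F2 x.2); last exact: prod_fclassE.
    by rewrite in_setXE !mem_fcl.
  rewrite in_setXE => /andP[/fcl_repr[S1r u1E] /fcl_repr[S2r u2E]] ->.
  exists (repr u.1, repr u.2); first by rewrite in_setXE S1r.
  by rewrite prod_fclassE /= -u1E -u2E.
rewrite fclE big_imset /=; last first.
  move=> u v; rewrite !in_setXE => /andP[Fu1 Fu2] /andP[Fv1 Fv2] /setP uv.
  have := uv (repr u.1, repr u.2); rewrite !in_setXE /= !(mem_repr_fcl Fu1) (mem_repr_fcl Fu2).
  case/esym/andP=> uv1 uv2; rewrite [u]surjective_pairing [v]surjective_pairing.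
  by rewrite (fcl_eq Fu1 Fv1 (mem_repr_fcl Fu1) uv1) (fcl_eq Fu2 Fv2 (mem_repr_fcl Fu2) uv2).
by rewrite pair_big /=; apply: eq_bigl => u; rewrite in_setXE.
Qed.

Lemma card_prod_fcl : #|fcl F| = (#|fcl F1| * #|fcl F2|)%N.
Proof.
rewrite -sum1_card big_prod_fcl; under eq_bigr do rewrite sum1_card.
by rewrite sum_nat_const.
Qed.

Lemma cent1_prod (x : gT1 * gT2) :
  'C_(setX S1 S2)[x] = setX 'C_S1[x.1] 'C_S2[x.2].
Proof.
apply/setP=> y; rewrite !(in_setXE, in_setI) andbACA; congr (_ && _).
apply/cent1P/andP => [[c1 c2]|[/cent1P c1 /cent1P c2]].
  by split; apply/cent1P.
by case: x y c1 c2 => [x1 x2] [y1 y2] /= c1 c2; congr (_, _).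
Qed.

Lemma max_cent_prod C1 C2 : C1 \in fcl F1 -> C2 \in fcl F2 ->
  max_cent (setX S1 S2) (setX C1 C2) = (max_cent S1 C1 * max_cent S2 C2)%N.
Proof.
move=> FC1 FC2; apply/eqP; rewrite eqn_leq; apply/andP; split.
  apply/bigmax_leqP=> x; rewrite in_setXE => /andP[x1 x2].
  rewrite cent1_prod cardsX leq_mul //.
    exact: (leq_bigmax_cond (F := fun y => #|'C_S1[y]|)).
  exact: (leq_bigmax_cond (F := fun y => #|'C_S2[y]|)).
have [x1 Cx1 x1max] := fully_centralised_fcl FC1.
have [x2 Cx2 x2max] := fully_centralised_fcl FC2.
rewrite (max_cent_fully FC1 Cx1 x1max) (max_cent_fully FC2 Cx2 x2max).
rewrite -cardsX -(cent1_prod (x1, x2)).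
apply: (leq_bigmax_cond (F := fun y => #|'C_(setX S1 S2)[y]|)).
by rewrite in_setXE Cx1.
Qed.

End ProductClasses.

(** * Class functions on a direct product *)

Section ProductCharacters.

Local Open Scope ring_scope.

Variables (gT1 gT2 : finGroupType) (S1 : {group gT1}) (S2 : {group gT2}).

Local Notation S := (setX S1 S2).

Lemma cftens_subproof (f1 : 'CF(S1)) (f2 : 'CF(S2)) :
  is_class_fun <<S>>%g [ffun x => f1 x.1 * f2 x.2].
Proof.
rewrite genGid; apply: intro_class_fun => [x y Sx|x].
  by rewrite inE => /andP[Sy1 Sy2]; rewrite !cfunJ.
by rewrite inE negb_and => /orP[]/cfun0->; rewrite ?mul0r ?mulr0.
Qed.

Definition cftens f1 f2 : 'CF(S) := Cfun 0 (cftens_subproof f1 f2).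

Lemma cftensE f1 f2 x : cftens f1 f2 x = f1 x.1 * f2 x.2.
Proof. by rewrite cfunE. Qed.

Lemma vchar_morphim (aT rT : finGroupType) (D K : {group aT}) (H : {group rT})
    (f : {morphism D >-> rT}) (phi : 'CF(H)) :
    K \subset D -> f @* K = H -> phi \in 'Z[irr H] ->
  exists2 psi : 'CF(K), psi \in 'Z[irr K] & {in K, forall x, psi x = phi (f x)}.
Proof.
move=> sKD fK; have HE : H = (f @* K)%G by apply: val_inj.
subst H => /vcharP[chi1 Nchi1 [chi2 Nchi2 ->]].
exists (cfMorph chi1 - cfMorph chi2).
  by rewrite rpredB ?char_vchar ?cfMorph_char.
by move=> x Kx; rewrite !cfunE !cfMorphE.
Qed.

(** The tensor product is the pointwise product of the inflations along the two projections. *)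
Lemma cftens_vchar f1 f2 :
  f1 \in 'Z[irr S1] -> f2 \in 'Z[irr S2] -> cftens f1 f2 \in 'Z[irr S].
Proof.
move=> Zf1 Zf2.
have [psi1 Zpsi1 psi1E] := vchar_morphim (subsetT _) (morphim_fstX S1 S2) Zf1.
have [psi2 Zpsi2 psi2E] := vchar_morphim (subsetT _) (morphim_sndX S1 S2) Zf2.
suff -> : cftens f1 f2 = psi1 * psi2 by rewrite mul_vchar.
by apply/cfun_inP=> x Sx; rewrite !cfunE psi1E ?psi2E.
Qed.

Lemma cfslice_subproof (phi : 'CF(S)) x : x \in S1 ->
  is_class_fun <<S2>>%g [ffun y => phi (x, y)].
Proof.
move=> Sx; rewrite genGid; apply: intro_class_fun => [y z Sy Sz|y Sy].
  have -> : (x, y ^ z)%g = ((x, y) ^ (1, z))%g by rewrite -[in LHS](conjg1 x).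
  by rewrite cfunJ // in_setXE group1.
by rewrite cfun0 // in_setXE negb_and Sy orbT.
Qed.

Definition cfslice phi x (Sx : x \in S1) : 'CF(S2) := Cfun 0 (cfslice_subproof phi Sx).

Lemma cfpartial_subproof (phi : 'CF(S)) (chi : 'CF(S2)) :
  is_class_fun <<S1>>%g
    [ffun x => #|S2|%:R^-1 * \sum_(y in S2) phi (x, y) * (chi y)^*].
Proof.
rewrite genGid; apply: intro_class_fun => [x z Sx Sz|x Sx].
  congr (_ * _); apply: eq_bigr => y Sy; congr (_ * _).
  have -> : (x ^ z, y)%g = ((x, y) ^ (z, 1))%g by rewrite -[in LHS](conjg1 y).
  by rewrite cfunJ // in_setXE group1 andbT.
by rewrite big1 ?mulr0 // => y _; rewrite [phi _]cfun0 ?mul0r // in_setXE negb_and Sx.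
Qed.

(** Inner product with [chi] in the second variable alone; for irreducible [chi] it is the
    coefficient of [chi] in [phi], as a function of the first variable. *)
Definition cfpartial phi chi : 'CF(S1) := Cfun 0 (cfpartial_subproof phi chi).

Lemma cfpartial_slice phi chi x (Sx : x \in S1) :
  cfpartial phi chi x = '[cfslice phi Sx, chi].
Proof.
rewrite cfunE cfdotE; congr (_ * _); apply: eq_bigr => y _.
by rewrite cfunE.
Qed.

Lemma cfpartial_sum (phi : 'CF(S)) x y : x \in S1 -> y \in S2 ->
  phi (x, y) = \sum_j cfpartial phi 'chi_j x * 'chi[S2]_j y.
Proof.
move=> Sx Sy; transitivity (cfslice phi Sx y : algC); first by rewrite cfunE.
rewrite [cfslice _ _]cfun_sum_cfdot sum_cfunE; apply: eq_bigr => j _.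
by rewrite cfunE -cfpartial_slice.
Qed.

Lemma cfdot_cfpartial phi chi1 chi2 :
  '[cfpartial phi chi2, chi1] = '[phi, cftens chi1 chi2].
Proof.
rewrite !cfdotE cardsX natrM invfM -mulrA; congr (_ * _).
transitivity (\sum_(x in S1) #|S2|%:R^-1 *
    \sum_(y in S2) phi (x, y) * (chi2 y)^* * (chi1 x)^*).
  by apply: eq_bigr => x Sx; rewrite cfunE -mulrA mulr_suml.
rewrite -mulr_sumr pair_big /=; congr (_ * _); apply: eq_big => [u|[x y] _].
  by rewrite in_setXE.
by rewrite cfunE rmorphM /= -mulrA [_^* * _]mulrC.
Qed.

Lemma cfpartial_vchar phi chi :
  phi \in 'Z[irr S] -> chi \in 'Z[irr S2] -> cfpartial phi chi \in 'Z[irr S1].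
Proof.
move=> Zphi Zchi; rewrite [cfpartial _ _]cfun_sum_cfdot; apply: rpred_sum => i _.
rewrite scale_zchar ?irr_vchar // cfdot_cfpartial.
by rewrite (Cint_cfdot_vchar (G := setX_group S1 S2)) // cftens_vchar // irr_vchar.
Qed.

End ProductCharacters.

(** * Determinant of a Kronecker product *)

Section TensorDeterminant.

Local Open Scope ring_scope.

Lemma det_castmx (R : comPzRingType) m n (e e' : m = n) (A : 'M[R]_m) :
  \det (castmx (e, e') A) = \det A.
Proof.
by subst n; rewrite [e'](eq_irrelevance _ (erefl m)) castmx_id.
Qed.

Lemma det_tens1mx (R : comPzRingType) m n (B : 'M[R]_n) :
  \det ((1%:M : 'M[R]_m) *t B) = \det B ^+ m.
Proof.
elim: m => [|m IHm]; first by rewrite expr0 det_mx00.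
have -> : (1%:M : 'M[R]_m.+1) = block_mx (1%:M : 'M_1) 0 0 (1%:M : 'M_m).
  by rewrite -scalar_mx_block.
rewrite tens_block_mx tens0mx tens0mx det_castmx det_ublock IHm exprS.
by rewrite tens_scalar1mx det_castmx.
Qed.

(** Swapping the two index components turns this product into the block diagonal one of
    [det_tens1mx]. The same permutation acts on rows and columns, so its sign cancels. *)
Lemma det_tensmx1 (R : comPzRingType) m n (A : 'M[R]_m) :
  \det (A *t (1%:M : 'M[R]_n)) = \det A ^+ n.
Proof.
have e : (n * m = m * n)%N by apply: mulnC.
pose s (k : 'I_(m * n)) : 'I_(n * m) :=
  mxtens_index ((mxtens_unindex k).2, (mxtens_unindex k).1).
pose t := cast_ord e \o s.
have s_inj : injective s.
  move=> k l /(can_inj (@mxtens_indexK n m))[e1 e2].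
  apply: (can_inj (@mxtens_unindexK m n)).
  by rewrite [LHS]surjective_pairing [RHS]surjective_pairing; congr (_, _); apply: val_inj.
have t_inj : injective t by apply: inj_comp s_inj; apply: cast_ord_inj.
pose M := castmx (e, e) ((1%:M : 'M[R]_n) *t A).
have -> : A *t 1%:M = row_perm (perm t_inj) (col_perm (perm t_inj) M).
  apply/matrixP=> i j; rewrite !mxE !permE castmxE !cast_ordK.
  by rewrite tensmxE mxE mulrC.
rewrite row_permE col_permE !det_mulmx !det_perm odd_permV mulrA mulrAC.
by rewrite -signr_addb addbb expr0 mul1r det_castmx det_tens1mx.
Qed.

Lemma det_tensmx (R : comPzRingType) m n (A : 'M[R]_m) (B : 'M[R]_n) :
  \det (A *t B) = \det A ^+ n * \det B ^+ m.
Proof. by rewrite tensmx_decr det_mulmx det_tensmx1 det_tens1mx. Qed.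

End TensorDeterminant.

(** * The lattice of a product is the tensor product of the lattices *)

Section ProductBasis.

Local Open Scope ring_scope.

Variables (gT1 gT2 : finGroupType) (S1 : {group gT1}) (S2 : {group gT2}).
Variables (F1 : fusion_system S1) (F2 : fusion_system S2).

Let F := prod_fusion F1 F2.

Lemma cftens_stable f1 f2 : fstable F1 f1 -> fstable F2 f2 -> fstable F (cftens f1 f2).
Proof.
move=> /fstableP st1 /fstableP st2; apply/fstableP=> x y.
by rewrite prod_fclassE in_setXE !cftensE => /andP[/st1-> /st2->].
Qed.

Variables (r1 r2 : nat) (B1 : 'I_r1 -> 'CF(S1)) (B2 : 'I_r2 -> 'CF(S2)).
Hypothesis basis1 : is_Zbasis (stable_vchar F1) B1.
Hypothesis basis2 : is_Zbasis (stable_vchar F2) B2.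

Definition tens_basis (k : 'I_(r1 * r2)) : 'CF(setX_group S1 S2) :=
  cftens (B1 (mxtens_unindex k).1) (B2 (mxtens_unindex k).2).

Lemma tens_basis_sum (c : 'I_(r1 * r2) -> int) x y :
  (\sum_k tens_basis k *~ c k) (x, y) =
  \sum_i (\sum_j (c (mxtens_index (i, j)))%:~R * B2 j y) * B1 i x.
Proof.
rewrite sum_cfunE (reindex (@mxtens_index r1 r2)) /=; last first.
  by exists (@mxtens_unindex r1 r2) => k _; rewrite (mxtens_indexK, mxtens_unindexK).
under [RHS]eq_bigr do rewrite mulr_suml.
rewrite pair_bigA /=; apply: eq_bigr => -[i j] _ /=.
by rewrite -scaler_int cfunE cftensE mxtens_indexK /= -mulrA; congr (_ * _); apply: mulrC.
Qed.

Lemma sum_basis_eq (gT : finGroupType) (S : {group gT}) (K : fusion_system S) r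
    (B : 'I_r -> 'CF(S)) (a b : 'I_r -> algC) :
    is_Zbasis (stable_vchar K) B ->
  {in S, forall x, \sum_i a i * B i x = \sum_i b i * B i x} -> a =1 b.
Proof.
move=> basisB ab; apply: (basis_coord_uniq basisB); apply/cfun_inP=> x Sx.
rewrite !sum_cfunE; under eq_bigr do rewrite cfunE.
by under [RHS]eq_bigr do rewrite cfunE; exact: ab.
Qed.

Lemma tens_basis_mem k : tens_basis k \in stable_vchar F.
Proof.
have := basis1.1 (mxtens_unindex k).1; have := basis2.1 (mxtens_unindex k).2.
rewrite !stable_vcharE => /andP[Z2 st2] /andP[Z1 st1].
by rewrite cftens_vchar // cftens_stable.
Qed.

Lemma cfpartial_stable (phi : 'CF(setX_group S1 S2)) chi :
  fstable F phi -> fstable F1 (cfpartial phi chi).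
Proof.
move/fstableP=> st; apply/fstableP=> x y yx; rewrite !cfunE; congr (_ * _).
apply: eq_bigr => z Sz; rewrite (st (x, z) (y, z)) // prod_fclassE in_setXE yx.
exact: fclass_refl.
Qed.

(* Expand phi along S2, each coefficient on B1, and use the freeness of B1 to *)
(* see that the resulting class functions on S2 are stable.                   *)
Lemma tens_basis_gen phi : phi \in stable_vchar F ->
  exists c : 'I_(r1 * r2) -> int, phi = \sum_k tens_basis k *~ c k.
Proof.
rewrite stable_vcharE => /andP[Zphi st].
have R1 (j : Iirr S2) : cfpartial phi 'chi_j \in stable_vchar F1.
  by rewrite stable_vcharE cfpartial_stable // cfpartial_vchar ?irr_vchar.
have /fin_all_exists[c cE] j := Zbasis_coord basis1 (R1 j).
pose g i := \sum_j 'chi[S2]_j *~ c j i.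
have phiE x y : x \in S1 -> y \in S2 -> phi (x, y) = \sum_i g i y * B1 i x.
  move=> Sx Sy; rewrite (cfpartial_sum phi Sx Sy).
  under eq_bigr do rewrite cE sum_cfunE mulr_suml.
  rewrite exchange_big; apply: eq_bigr => i _; rewrite sum_cfunE mulr_suml.
  apply: eq_bigr => j _; rewrite -!scaler_int !cfunE.
  by rewrite mulrAC.
have R2 i : g i \in stable_vchar F2.
  rewrite stable_vcharE; apply/andP; split.
    by apply: rpred_sum => j _; rewrite rpredMz ?irr_vchar.
  apply/fstableP=> y z zy; have /andP[Sy Sz] := fclass_mem zy.
  apply: (sum_basis_eq (a := fun i => g i z) (b := fun i => g i y) basis1).
  move=> x Sx; rewrite -!phiE //; have /fstableP := st; apply.
  by rewrite prod_fclassE in_setXE zy fclass_refl.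
have /fin_all_exists[d dE] i := Zbasis_coord basis2 (R2 i).
exists (fun k => d (mxtens_unindex k).1 (mxtens_unindex k).2).
apply/cfun_inP=> -[x y]; rewrite in_setX => /andP[Sx Sy].
rewrite phiE // tens_basis_sum; apply: eq_bigr => i _; congr (_ * _).
rewrite dE sum_cfunE; apply: eq_bigr => j _.
by rewrite mxtens_indexK -scaler_int cfunE.
Qed.

Lemma tens_basis_Zbasis : is_Zbasis (stable_vchar F) tens_basis.
Proof.
split=> [|phi Rphi]; first exact: tens_basis_mem.
have [c cE] := tens_basis_gen Rphi; exists [ffun k => c k]; split.
  by rewrite cE; apply: eq_bigr => k _; rewrite ffunE.
move=> d dE; apply/ffunP=> k; rewrite ffunE.
case: (mxtens_indexP k) => i j; apply: (@intr_inj algC).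
apply: (sum_basis_eq (a := fun j => (c (mxtens_index (i, j)))%:~R)
  (b := fun j => (d (mxtens_index (i, j)))%:~R) basis2) => y Sy.
(* For fixed [y] the coefficients on [B1] are complex numbers, so independence over the complex
   numbers is used. *)
apply: (sum_basis_eq (a := fun i => \sum_j (c (mxtens_index (i, j)))%:~R * B2 j y)
  (b := fun i => \sum_j (d (mxtens_index (i, j)))%:~R * B2 j y) basis1) => x Sx.
by rewrite -!tens_basis_sum -cE -dE.
Qed.

Lemma gram_tens : gram F tens_basis = gram F1 B1 *t gram F2 B2.
Proof.
apply/matrixP=> k l; rewrite !mxE big_prod_fcl mulr_suml.
apply: eq_bigr => C1 FC1; rewrite mulr_sumr; apply: eq_bigr => C2 FC2.
have FC : setX C1 C2 \in fcl F.
  have [S1r C1E] := fcl_repr FC1; have [S2r C2E] := fcl_repr FC2.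
  rewrite {1}C1E {1}C2E -[setX _ _](prod_fclassE F1 F2 (repr C1, repr C2)).
  by rewrite mem_fcl // in_setX S1r.
have rC : (repr C1, repr C2) \in setX C1 C2.
  by rewrite in_setX (mem_repr_fcl FC1) (mem_repr_fcl FC2).
(* The chosen representative of a product class may differ from the pair of representatives;
   stability equates the values. *)
have val m : tens_basis m (repr (setX C1 C2)) = tens_basis m (repr C1, repr C2).
  have := tens_basis_mem m; rewrite stable_vcharE => /andP[_ st].
  by rewrite [RHS](fstable_repr st FC rC).
by rewrite !val !cftensE rmorphM mulrACA.
Qed.

End ProductBasis.

(** * The conjecture for products *)

Section Product.

Local Open Scope ring_scope.

Variables (gT1 gT2 : finGroupType) (S1 : {group gT1}) (S2 : {group gT2}).
Variables (F1 : fusion_system S1) (F2 : fusion_system S2).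

Theorem prod_conjectureA :
  conjectureA F1 -> conjectureA F2 -> conjectureA (prod_fusion F1 F2).
Proof.
move=> conj1 conj2 B basisB X XF.
have [r1 [B1 basis1]] := stable_vchar_basis F1.
have [r2 [B2 basis2]] := stable_vchar_basis F2.
have basisT := tens_basis_Zbasis basis1 basis2.
have r12 : (r1 * r2 = #|fcl F1| * #|fcl F2|)%N.
  by rewrite -card_prod_fcl; exact: (Zbasis_card (stable_vchar_zmod _) basisT basisB).
have fcl_gt0 gT (S : {group gT}) (K : fusion_system S) : (0 < #|fcl K|)%N.
  by apply/card_gt0P; exists (fclass K 1%g); rewrite mem_fcl.
(* Each rank is at most the positive number of classes of its factor, and the products agree by
   [r12], so both bounds are attained. *)
have r1E : r1 = #|fcl F1|.
  apply/eqP; rewrite eqn_leq (basis_card_le basis1) /= -(leq_pmul2r (fcl_gt0 _ _ F2)).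
  by rewrite -r12 leq_mul2l (basis_card_le basis2) orbT.
have r2E : r2 = #|fcl F2|.
  apply/eqP; rewrite eqn_leq (basis_card_le basis2) /= -(leq_pmul2l (fcl_gt0 _ _ F1)).
  by rewrite -r12 r1E.
have [X1 X1F] := is_fccl_exists F1; have [X2 X2F] := is_fccl_exists F2.
have det1 := (conjectureA_gram basis1 X1F r1E).1 conj1.
have det2 := (conjectureA_gram basis2 X2F r2E).1 conj2.
rewrite det_gram_char_matrix (det_gram_basis basisB basisT) gram_tens //.
rewrite det_tensmx det1 det2 -!natrX -natrM; congr (_%:R).
rewrite (prod_card_fccl XF) (prod_card_fccl X1F) (prod_card_fccl X2F) r1E r2E.
rewrite big_prod_fcl; symmetry.
transitivity (\prod_(C1 in fcl F1) (max_cent S1 C1 ^ #|fcl F2| *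
    \prod_(C2 in fcl F2) max_cent S2 C2))%N.
  apply: eq_bigr => C1 FC1; rewrite -prod_nat_const -big_split.
  by apply: eq_bigr => C2 FC2; rewrite (max_cent_prod FC1 FC2).
rewrite big_split /= prod_nat_const; congr (_ * _)%N.
by rewrite (big_morph (expn^~ _) (fun a b => expnMn a b _) (exp1n _)).
Qed.

End Product.

Theorem theoremA (p : nat) (p_pr : prime p) :
  [/\ forall (gT : finGroupType) (S : {group gT}) (F : fusion_system S),
        p.-group S -> #|fcl F| = 2 -> conjectureA F,
      forall (gT : finGroupType) (G S : {group gT}) (sSG : S \subset G),
        p.-Sylow(G) S -> conjectureA (group_fusion sSG)
    & forall (gT1 gT2 : finGroupType) (S1 : {group gT1}) (S2 : {group gT2})
             (F1 : fusion_system S1) (F2 : fusion_system S2),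
        p.-group S1 -> p.-group S2 ->
        conjectureA F1 -> conjectureA F2 -> conjectureA (prod_fusion F1 F2)].
Proof.
split=> [gT S F pS|gT G S sSG|gT1 gT2 S1 S2 F1 F2 _ _].
- exact: transitive_conjectureA pS.
- exact: group_conjectureA.
- exact: prod_conjectureA.
Qed.
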